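(* There is an absolute constant $C>0$ such that the following holds. Let $\mathbb{F}_q$ be a finite field of characteristic $p > n \ge 2$, let $\mathbf{h} = (h_0,\ldots,h_{n-1}) \in (\mathbb{F}_q^* )^n$, and let $\mathbf{G} = (\mathcal{G}_0,\ldots,\mathcal{G}_{n-1})$ be a sequence of $n$ arbitrary multiplicative subgroups of $\mathbb{F}_q^*$. Then \[ \left| \#\mathcal{I}_n(\mathbf{h},\mathbf{G}) - \frac{1}{n}\prod_{j=0}^{n-1}\#\mathcal{G}_j \right| \le C\left(n^2 q^{n-1/2} + n^5 q^{n-1}\right). \]
   Context: $\mathbb{F}_q$ denotes the finite field of $q$ elements and $\#S$ the cardinality of a finite set $S$. $\mathcal{I}_n(\mathbf{h},\mathbf{G})$ is the set of monic irreducible polynomials $f \in \mathbb{F}_q[X]$ of the form $f(X) = X^n + a_{n-1}X^{n-1} + \cdots + a_0$ with $a_i \in h_i\mathcal{G}_i$ for $i=0,\ldots,n-1$. *)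

(* Defs.v *)
From HB Require Import structures.
From mathcomp Require Import all_boot all_order all_fingroup all_algebra.
From mathcomp Require Import reals exp.

Set Implicit Arguments.
Unset Strict Implicit.
Unset Printing Implicit Defensive.

Import Order.TTheory GRing.Theory Num.Theory.
Local Open Scope ring_scope.

(* The multiplicative subgroups of F^* are the finite groups of elements of
   {unit F}. The coset h_i G_i lives in {unit F}, hence the injection
   FinRing.uval into F. The polynomials are taken in the finite type
   {poly_n.+1 F} of polynomials of degree at most n, so that the set is a
   {set _} with a cardinality. *)
Definition irred_cosets (F : finFieldType) (n : nat)
    (h : 'I_n -> {unit F}) (G : 'I_n -> {group {unit F}}) :
    {set {poly_n.+1 F}} :=
  [set f : {poly_n.+1 F} |
    [&& (f : {poly F}) \is monic, size (f : {poly F}) == n.+1,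
        irreducibleb (f : {poly F}) &
        [forall i : 'I_n,
          (f : {poly F})`_i \in FinRing.uval @: (h i *: G i)%g]]].

(* Main.v *)
Require Import Defs.
From HB Require Import structures.
From mathcomp Require Import all_boot all_order all_fingroup all_algebra.
From mathcomp Require Import all_solvable all_field all_character.
From mathcomp Require Import reals exp.
From mathcomp Require Import ring lra zify.

Set Implicit Arguments.
Unset Strict Implicit.
Unset Printing Implicit Defensive.

Import Order.TTheory GRing.Theory Num.Theory.
Local Open Scope ring_scope.

(** Write q for the order of F, k = n - 1, and a_0, ..., a_k for the coefficients
of a monic polynomial f of degree n.

Reduction to character sums.  Since n is less than the characteristic, Newton's
identities make (a_1, ..., a_k) and the vector v(f) of the first k power sums of
the roots of f determine each other ([power_sum_middle]).  Hence f lies in the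
box if and only if v(f) lies in a certain set E of vectors and a_0 lies in
h_0 G_0.  Expand the first condition in additive characters of F^k and the
second one in the characters of the quotient of F^* by G_0.  The count becomes
a combination of the sums over irreducible f of

    w(f) = psi (sum_i xi_i v_i(f)) * chi (f(0)),

and these weights are completely multiplicative in f.  Everything rests on how
small the Fourier coefficients are: those of a coset of a subgroup have l^1 norm
at most 1, and those of E, which may be any set, have l^1 norm at most q^(k/2)
by Cauchy-Schwarz and Parseval ([sum_E_hat]).  The trivial character yields the
main term up to a factor q/(q-1), and each other character sum is O(n q^(n/2))
by Weil's bound.  The total error for n times the count is therefore
O(n q^(n/2) q^((n-1)/2)) = O(n q^(n - 1/2)), and division by n gives the claim.

Weil's bound.  By unique factorization the generating series of the sums of w
over monic polynomials of each degree has as logarithmic derivative the series of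
the sums S_m of w over prime powers of degree m ([log_derivative]); S_m is also
a sum over the field with q^m elements ([sum_conj]).  For nontrivial w the sum
over the monic polynomials of degree j vanishes when j > k, because the first k
power sums and f(0) are then independent of each other.  So the series is a
polynomial and S_m = - sum_i w_i^m for at most k complex numbers w_i
([newton_inversion]).
To see that |w_i| <= q^(1/2) it is enough to bound S_m by a constant times
q^(m/2) for even m, with a constant independent of m ([power_sums_growth]).  On
the field L with q^m elements S_m is the sum of psi (Tr P(x)) chi (N(x)) for a
polynomial P of degree at most k.  Elements with given values of Tr P(x) and
N(x) are parametrized by the points of a curve y^q - y = R(z), and the number
of its points is bounded above by the method of Stepanov and Bombieri
([card_curve]).  The upper bounds suffice: their sum over all values of (Tr, N)
exceeds the order of L^* by only O(q^(m/2)), so none of them can be far from the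
truth ([prime_power_sum_even_bound]). *)

(** * Functions on the points of the curve y^q - y = R(z), filtered by pole order *)

Section CurvePoints.

Variables (L : finFieldType) (V : finType) (z y : V -> L).
Variables (q K Kinv : nat) (R : {poly L}).
Hypothesis q_gt1 : (1 < q)%N.
Hypothesis size_R : size R = K.+1.
Hypothesis K_gt0 : (0 < K)%N.
Hypothesis KinvP : (K * Kinv = 1 %[mod q])%N.
Hypothesis curve_eq : forall v, y v ^+ q = y v + R.[z v].

Local Notation fV := {ffun V -> L^o}.

(** The points of the curve are given by an abstract finite type V with
coordinates z and y.  At the point at infinity z has a pole of order q and y
one of order K, the degree of R, so [mono a i] has a pole of order q a + K i.
*)
Definition mono a i : fV := [ffun v => z v ^+ a * y v ^+ i].
(** As K is prime to q, an integer u has at most one expression u = q a + K i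
with i < q; [ydeg u] is the only candidate for i. *)
Definition ydeg u := ((u * Kinv) %% q)%N.
(** Membership in the numerical semigroup generated by q and K, which is the
set of pole orders. *)
Definition is_order u := (K * ydeg u <= u)%N.
Definition mono_of u := mono ((u - K * ydeg u) %/ q) (ydeg u).
(** The restrictions to V of the functions whose poles have order less than w.
The proofs never refer to poles: all relations hold between functions on the
finite set V. *)
Definition below w : {vspace fV} :=
  <<[seq mono_of u | u <- iota 0 w & is_order u]>>%VS.

Lemma order_mono a i : (i < q)%N ->
  is_order (q * a + K * i) /\ mono_of (q * a + K * i) = mono a i.
Proof.
move=> lt_iq; have Ey : ydeg (q * a + K * i) = i.
  rewrite /ydeg mulnDl -mulnA mulnC modnMDl -mulnA (mulnC i) mulnA.
  by rewrite -modnMml KinvP modnMml mul1n modn_small.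
by rewrite /is_order /mono_of Ey leq_addl addnK mulKn // ltnW.
Qed.

Lemma orderE u : is_order u ->
  (ydeg u < q)%N /\ u = (q * ((u - K * ydeg u) %/ q) + K * ydeg u)%N.
Proof.
move=> ou; split; first by rewrite ltn_mod ltnW.
suff dv : (q %| u - K * ydeg u)%N by rewrite mulnC divnK // subnK.
rewrite -eqn_mod_dvd // eq_sym /ydeg modnMmr mulnCA mulnC; apply/eqP.
by rewrite -modnMml KinvP modnMml mul1n.
Qed.

Lemma large_order u : (K * q <= u)%N -> is_order u.
Proof.
by move=> le_u; apply: leq_trans le_u; rewrite leq_mul2l ltnW ?orbT // ltn_mod ltnW.
Qed.

Lemma mem_below u w : (u < w)%N -> is_order u -> mono_of u \in below w.
Proof.
move=> lt_uw ou; apply/memv_span/map_f.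
by rewrite mem_filter ou mem_iota add0n leq0n.
Qed.

Lemma below_sub w (U : {vspace fV}) :
  (forall u, (u < w)%N -> is_order u -> mono_of u \in U) -> (below w <= U)%VS.
Proof.
move=> sub; apply/span_subvP => f /mapP[u]; rewrite mem_filter mem_iota.
by case/andP=> ou /andP[_ lt_uw] ->; apply: sub.
Qed.

Lemma below_mono w w' : (w <= w')%N -> (below w <= below w')%VS.
Proof.
by move=> le_ww'; apply: below_sub => u lt_u; apply/mem_below/(leq_trans lt_u).
Qed.

Lemma below_le f w w' : f \in below w -> (w <= w')%N -> f \in below w'.
Proof. by move=> fw /below_mono/subvP; apply. Qed.

Lemma dim_below w : (\dim (below w) <= w)%N.
Proof.
apply: leq_trans (dim_span _) _.
by rewrite size_map size_filter (leq_trans (count_size _ _)) ?size_iota.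
Qed.

(** Using y^q = y + R(z), every monomial agrees up to a nonzero factor and
lower-order terms with the reduced monomial of the same order.  The top term
of R(z) is the only one that preserves the order when y^q is replaced. *)
Lemma mono_reduce i a : is_order (q * a + K * i) /\
  exists2 c : L, c != 0 &
    mono a i - c *: mono_of (q * a + K * i) \in below (q * a + K * i).
Proof.
elim/ltn_ind: i a => i IH a.
have [lt_iq|le_qi] := ltnP i q.
  have [oi ->] := order_mono a lt_iq; split=> //.
  by exists 1; rewrite ?oner_neq0 // scale1r subrr mem0v.
have IH1 j b : (j < i)%N -> mono b j \in below (q * b + K * j).+1.
  move=> /IH/(_ b)[o [c _ ib]].
  rewrite -[mono b j](subrK (c *: mono_of (q * b + K * j))).
  by rewrite rpredD ?(below_le ib) ?rpredZ ?mem_below.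
have Ew : (q * (a + K) + K * (i - q) = q * a + K * i)%N.
  by rewrite mulnBr; have := leq_mul2l K q i; rewrite le_qi orbT; lia.
have lt_iqi : (i - q < i)%N by lia.
have [o [c c0 ib]] := IH _ lt_iqi (a + K)%N; rewrite Ew in o ib; split=> //.
have lead0 : R`_K != 0.
  by have := lead_coef_eq0 R; rewrite /lead_coef size_R /= -size_poly_eq0 size_R => ->.
exists (R`_K * c); first by rewrite mulf_neq0.
have -> : mono a i = mono a (i - q).+1 + (\sum_(l < K) R`_l *: mono (a + l) (i - q))
           + R`_K *: mono (a + K) (i - q).
  apply/ffunP=> v; rewrite !ffunE sum_ffunE.
  under eq_bigr => l _ do rewrite !ffunE.
  have {1}-> : i = (i - q + q)%N by lia.
  rewrite exprD curve_eq exprS horner_coef size_R big_ord_recr /= !mulrDr.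
  rewrite addrA; congr (_ + _ + _).
  - by ring.
  - rewrite mulrA mulr_sumr; apply: eq_bigr => l _.
    rewrite /GRing.scale /= exprD; ring.
  - rewrite /GRing.scale /= exprD; ring.
rewrite -addrA rpredD //.
  rewrite rpredD //.
    apply: below_le (IH1 _ _ _) _; first by lia.
    have : (K * (i - q).+1 < K * i)%N by rewrite ltn_mul2l K_gt0; lia.
    by lia.
  rewrite rpred_sum // => l _; rewrite rpredZ //.
  apply: below_le (IH1 _ _ _) _; first by lia.
  rewrite -Ew ltn_add2r ltn_mul2l; have := ltn_ord l; lia.
by rewrite -scalerA -scalerBr rpredZ.
Qed.

Lemma orderD u w : is_order u -> is_order w -> is_order (u + w).
Proof.
move=> /orderE[_ ->] /orderE[_ ->]; rewrite addnACA -!mulnDr.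
by have [] := mono_reduce (ydeg u + ydeg w) ((u - K * ydeg u) %/ q + (w - K * ydeg w) %/ q).
Qed.

Lemma mem_mono i a : mono a i \in below (q * a + K * i).+1.
Proof.
have [o [c _ ib]] := mono_reduce i a.
rewrite -[mono a i](subrK (c *: mono_of (q * a + K * i))).
by rewrite rpredD ?(below_le ib) ?rpredZ ?mem_below.
Qed.

Lemma monoM a i b j : mono a i * mono b j = mono (a + b) (i + j).
Proof. by apply/ffunP => v; rewrite !ffunE /= !exprD; ring. Qed.

Lemma below_mulM a i f w : f \in below w ->
  mono a i * f \in below (w + (q * a + K * i)).
Proof.
rewrite /below -[map _ _]in_tupleE => /coord_span->; rewrite mulr_sumr rpred_sum //.
move=> l _; set c := coord _ _ _.
have -> (g : fV) : mono a i * (c *: g) = c *: (mono a i * g).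
  by apply/ffunP=> v; rewrite !ffunE /GRing.scale /=; ring.
rewrite rpredZ // in_tupleE.
have : (in_tuple [seq mono_of u | u <- iota 0 w & is_order u])`_l \in
   [seq mono_of u | u <- iota 0 w & is_order u].
  by apply: mem_nth; rewrite (ltn_ord l).
case/mapP=> u; rewrite mem_filter mem_iota => /andP[ou /andP[_ lt_u]].
rewrite in_tupleE => ->.
rewrite /mono_of monoM; apply: below_le (mem_mono _ _) _.
have [_] := orderE ou; rewrite !mulnDr; move: ((u - K * ydeg u) %/ q)%N (ydeg u) => b j; lia.
Qed.

Lemma belowM f g w w' : f \in below w.+1 -> g \in below w'.+1 ->
  f * g \in below (w + w').+1.
Proof.
move=> fw gw; move: fw.
rewrite /below -[map _ _]in_tupleE => /coord_span->; rewrite mulr_suml rpred_sum //.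
move=> l _; set c := coord _ _ _.
have -> (h : fV) : (c *: h) * g = c *: (h * g).
  by apply/ffunP=> v; rewrite !ffunE /GRing.scale /=; ring.
rewrite rpredZ // in_tupleE.
have : (in_tuple [seq mono_of u | u <- iota 0 w.+1 & is_order u])`_l \in
   [seq mono_of u | u <- iota 0 w.+1 & is_order u].
  by apply: mem_nth; rewrite (ltn_ord l).
case/mapP=> u; rewrite mem_filter mem_iota => /andP[ou /andP[_ lt_u]].
rewrite in_tupleE => ->; apply: below_le (below_mulM _ _ gw) _.
by have [_ <-] := orderE ou; lia.
Qed.

Hypothesis zy_inj : forall u v, z u = z v -> y u = y v -> u = v.

(** Lagrange interpolation: a product of affine functions in z or in y
separates a point from all the others. *)
Lemma below_full : exists M, below M = fullv.
Proof.
pose M := ((q + K) * #|V|)%N; exists M.+1; apply/eqP; rewrite eqEsubv subvf /=.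
have m1 w : (1 : fV) \in below w.+1.
  have <- : mono 0 0 = 1 by apply/ffunP => v; rewrite !ffunE expr0 mulr1.
  by apply: below_le (mem_mono 0 0) _; rewrite !muln0.
apply/subvP=> f _.
have -> : f = \sum_v f v *: [ffun u => (u == v)%:R : L^o].
  apply/ffunP=> u; rewrite sum_ffunE (bigD1 u) //= !ffunE eqxx big1 ?addr0.
    by rewrite /GRing.scale /= mulr1.
  by move=> v /negbTE vu; rewrite !ffunE eq_sym vu scaler0.
rewrite rpred_sum // => v _; rewrite rpredZ //.
pose sep u : fV := if z u != z v then [ffun x => (z x - z u) / (z v - z u)]
                   else [ffun x => (y x - y u) / (y v - y u)].
have sepE u : u != v -> sep u v = 1 /\ sep u u = 0.
  move=> uv; rewrite /sep; case: eqVneq => [zuv|zuv] /=; rewrite !ffunE subrr mul0r.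
    split=> //; apply: divff; rewrite subr_eq0; apply: contra uv => /eqP yuv.
    exact/eqP/zy_inj.
  by split=> //; apply: divff; rewrite subr_eq0 eq_sym.
have mem_sep u : sep u \in below (q + K).+1.
  have E (a b : L) (f1 : fV) : [ffun x => (f1 x - a) / b : L^o] = b^-1 *: f1 - (a / b) *: (1 : fV).
    by apply/ffunP=> x; rewrite !ffunE /GRing.scale /=; ring.
  rewrite /sep; case: ifP => _.
    have -> : [ffun x => (z x - z u) / (z v - z u)] =
              [ffun x => (mono 1 0 x - z u) / (z v - z u) : L^o].
      by apply/ffunP=> x; rewrite !ffunE expr1 expr0 mulr1.
    rewrite E rpredB ?rpredZ ?m1 //.
    by apply: below_le (mem_mono _ _) _; lia.
  have -> : [ffun x => (y x - y u) / (y v - y u)] =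
              [ffun x => (mono 0 1 x - y u) / (y v - y u) : L^o].
    by apply/ffunP=> x; rewrite !ffunE expr1 expr0 mul1r.
  rewrite E rpredB ?rpredZ ?m1 //.
  by apply: below_le (mem_mono _ _) _; lia.
have -> : [ffun u => (u == v)%:R : L^o] = \prod_(u <- rem v (enum V)) sep u.
  have prodE (s : seq V) x : (\prod_(u <- s) sep u) x = \prod_(u <- s) (sep u x : L).
    by elim: s => [|u s IH]; rewrite ?big_nil ?big_cons !ffunE //= IH.
  apply/ffunP=> x; rewrite ffunE prodE.
  have [->|xv] := eqVneq x v.
    rewrite big_seq big1 // => u.
    by rewrite mem_rem_uniq ?enum_uniq // inE => /andP[/sepE[]].
  have : x \in rem v (enum V).
    by rewrite mem_rem_uniq ?enum_uniq // inE xv mem_enum.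
  elim: (rem v _) => // u s IH; rewrite inE big_cons.
  case: eqVneq => [<-|_] /=; first by rewrite (sepE _ xv).2 mul0r.
  by move/IH<-; rewrite mulr0.
have le_s : (size (rem v (enum V)) <= #|V|)%N.
  by rewrite size_rem ?mem_enum // -cardE leq_pred.
suff H (s : seq V) : \prod_(u <- s) sep u \in below ((q + K) * size s).+1.
  by apply: below_le (H _) _; rewrite ltnS leq_mul2l le_s orbT.
elim: s => [|u s IH]; first by rewrite big_nil m1.
by rewrite big_cons mulnS belowM.
Qed.

(** This replaces the statement that a nonzero function with a pole of order u
has at most u zeros.  A relation that lowers the order of the monomial of
order u does the same, after multiplication, for all orders of the form u +
(order).  The remaining orders span all functions on V, and no two of them are
congruent modulo u. *)
Lemma card_curve_le u : is_order u -> mono_of u \in below u -> (#|V| <= u)%N.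
Proof.
move=> ou zero_u; have [M EM] := below_full.
pose fresh w := is_order w && ~~ ((u <= w)%N && is_order (w - u)).
pose N w : {vspace fV} := <<[seq mono_of x | x <- iota 0 w & fresh x]>>%VS.
have N_mono w w' : (w <= w')%N -> (N w <= N w')%VS.
  move=> le_w; apply: sub_span => f /mapP[x].
  rewrite mem_filter mem_iota => /andP[fx /andP[_ lt_x]] ->.
  by apply: map_f; rewrite mem_filter fx mem_iota /=; lia.
have sub w : (below w <= N w)%VS.
  elim/ltn_ind: w => w IH; apply: below_sub => x lt_x ox.
  have [fx|] := boolP (fresh x).
    by apply/memv_span/map_f; rewrite mem_filter fx mem_iota.
  rewrite /fresh ox negbK /= => /andP[le_ux oxu].
  suff : mono_of x \in below x.
    by move/(subvP (IH _ lt_x)); apply/subvP/N_mono/ltnW.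
  have [_ Eu] := orderE ou; have [_ Exu] := orderE oxu.
  set a := (_ %/ q)%N in Eu; set i := ydeg u in Eu.
  set b := (_ %/ q)%N in Exu; set j := ydeg (x - u) in Exu.
  have := below_mulM b j zero_u; rewrite -Exu subnKC // monoM -/a -/i.
  have Ex : (q * (b + a) + K * (j + i) = x)%N.
    by move: (Exu) (Eu) le_ux; rewrite !mulnDr; clear; lia.
  have [_ [c c0]] := mono_reduce (j + i) (b + a); rewrite Ex.
  move=> h1 h2; have := rpredB h2 h1; rewrite opprB addrC subrK.
  by rewrite rpredZeq (negbTE c0).
have : (\dim (fullv : {vspace fV}) <= u)%N.
  rewrite -EM; apply: leq_trans (dimvS (sub M)) _.
  apply: leq_trans (dim_span _) _; rewrite size_map.
  case: (posnP u) => [u0|u_gt0].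
    rewrite (eq_filter (a2 := pred0)) ?filter_pred0 // => x.
    by rewrite /fresh u0 leq0n subn0 /= andbN.
  rewrite -(size_map (modn^~ u)) -[leqRHS](size_iota 0).
  apply: uniq_leq_size; last first.
    by move=> _ /mapP[x _ ->]; rewrite mem_iota /= add0n ltn_mod.
  rewrite map_inj_in_uniq ?filter_uniq ?iota_uniq //.
  have H x x' : fresh x -> fresh x' -> (x <= x')%N -> x = x' %[mod u] -> x = x'.
    move=> /andP[ox _] /andP[ox' fx'] le_x /eqP.
    rewrite eq_sym eqn_mod_dvd // => /dvdnP[[|t] Et]; first by lia.
    case/negP: fx'; have le_ux : (u <= x')%N by rewrite mulSn in Et; lia.
    rewrite le_ux /=; have -> : (x' - u = x + t * u)%N by rewrite mulSn in Et; lia.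
    elim: t {Et} => [|t IH]; first by rewrite addn0.
    by rewrite mulSn addnCA addnC orderD.
  move=> x x'; rewrite !mem_filter => /andP[fx _] /andP[fx' _] Exx'.
  by case/orP: (leq_total x x') => le; [|apply/esym]; apply: H.
suff -> : \dim (fullv : {vspace fV}) = #|V| by [].
by rewrite dimvf /dim /= muln1.
Qed.
End CurvePoints.

(** * The number of points on the curve y^q - y = R(z) *)

Section StepanovBombieri.

Variables (L : finFieldType) (V : finType) (z y : V -> L).
Variables (q K : nat) (R : {poly L}).
Hypothesis q_gt1 : (1 < q)%N.
Hypothesis size_R : size R = K.+1.
Hypothesis K_gt0 : (0 < K)%N.
Hypothesis coKq : coprime K q.
Hypothesis curve_eq : forall v, y v ^+ q = y v + R.[z v].
Hypothesis zy_inj : forall u v, z u = z v -> y u = y v -> u = v.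
Variable r : nat.
Hypothesis card_L : #|L| = (r ^ 2)%N.
Hypothesis rD : {morph (fun x : L => x ^+ r) : a b / a + b}.

Local Notation fV := {ffun V -> L^o}.
Local Notation mono := (mono z y).

(** The freeness criterion for families indexed by an arbitrary finite type.
*)
Lemma independent_card_le (J : finType) (U : {vspace fV}) (u : J -> fV) :
  (forall j, u j \in U) ->
  (forall b : J -> L, \sum_j b j *: u j = 0 -> forall j, b j = 0) ->
  (#|J| <= \dim U)%N.
Proof.
move=> uU free_u; pose X := [tuple u (enum_val i) | i < #|J|].
have : free X.
  apply/freeP=> k Ek i.
  pose b j := k (enum_rank j).
  suff /free_u/(_ (enum_val i)) : \sum_j b j *: u j = 0.
    by rewrite /b enum_valK.
  rewrite -[RHS]Ek (reindex (@enum_val J J)) /=; last first.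
    by apply: onW_bij; exact: enum_val_bij.
  by apply: eq_bigr => l _; rewrite /b enum_valK (nth_map l) ?nth_ord_enum // size_enum_ord.
move/eqP; rewrite size_tuple => <-; apply/dimvS/span_subvP => f /mapP[i _ ->].
exact: uU.
Qed.

(** The method of Stepanov as simplified by Bombieri.  Let s_i and t_j be
reduced monomials of orders c0 + i and c0 + j, for i < S and j < r.  If V had
more than the stated number of points, the products s_i t_j^r would be
linearly independent: since x^(r^2) = x on L, a relation sum b_ij s_i t_j^r =
0 on V has the r-th root sum b_ij^r s_i^r t_j = 0, whose terms have distinct
orders, which contradicts [card_curve_le].  But the products are S r in number
and lie in a space of dimension at most c0 + S + r (c0 + r), which is less. *)
Lemma card_curve_large : (2 * (K * q) + 3 < r)%N ->
  (#|V| <= r ^ 2 + (3 * (K * q) + 4) * r)%N.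
Proof.
move=> r_gt; set c0 := (K * q)%N in r_gt *.
have [Kinv KinvP] : exists Kinv, (K * Kinv = 1 %[mod q])%N.
  have [u v Eu _] := egcdnP q K_gt0; exists u.
  by rewrite mulnC Eu (eqP coKq) modnMDl.
pose a w := ((c0 + w - K * ydeg q Kinv (c0 + w)) %/ q)%N.
pose i w := ydeg q Kinv (c0 + w).
have wtE w : (q * a w + K * i w = c0 + w)%N.
  have ow : is_order q K Kinv (c0 + w) by apply: large_order; rewrite // leq_addr.
  by have [_ <-] := orderE q_gt1 KinvP ow.
(* S is chosen so that S * r exceeds the dimension bound used below, which is
   c0 + S + r * (c0 + r). *)
pose S := (r + c0 + 2)%N.
rewrite leqNgt; apply/negP=> V_gt.
pose J := ('I_S * 'I_r)%type.
pose u (j : J) : fV := mono (a j.1 + a j.2 * r) (i j.1 + i j.2 * r).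
pose B := below z y q K Kinv.
have uB j : u j \in B (c0 + S + r * (c0 + r))%N.
  apply: below_le (mem_mono q_gt1 size_R K_gt0 KinvP curve_eq _ _) _.
  have -> : (q * (a j.1 + a j.2 * r) + K * (i j.1 + i j.2 * r) =
     (q * a j.1 + K * i j.1) + r * (q * a j.2 + K * i j.2))%N by ring.
  rewrite !wtE; have lt1 := ltn_ord j.1.
  have : (r * (c0 + j.2) <= r * (c0 + r))%N.
    by rewrite leq_mul2l leq_add2l ltnW ?orbT.
  by lia.
have r2 (c : L) : (c ^+ r) ^+ r = c by rewrite -exprM mulnn -card_L expf_card.
have rsum (I : finType) (f : I -> L) : (\sum_k f k) ^+ r = \sum_k f k ^+ r.
  have r_gt0 : (0 < r)%N by lia.
  apply: (big_morph (fun c : L => c ^+ r) rD).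
  by rewrite expr0n; case: (r) r_gt0.
suff indep (b : J -> L) : \sum_j b j *: u j = 0 -> forall j, b j = 0.
  have := independent_card_le uB indep; rewrite card_prod !card_ord => le.
  have := leq_trans le (dim_below z y q K Kinv _).
  by rewrite /S; nia.
move=> b0 j1; apply/eqP/negPn/negP => bj1.
pose wt (j : J) := (r * (c0 + j.1) + (c0 + j.2))%N.
(* j0 is the term of the r-th root of the relation with the largest order. *)
case: (@arg_maxnP _ j1 (fun j => b j != 0) wt bj1) => j0 bj0 max_j0.
pose t (j : J) : fV := mono (a j.1 * r + a j.2) (i j.1 * r + i j.2).
have t0 : \sum_j b j ^+ r *: t j = 0.
  apply/ffunP=> v; rewrite sum_ffunE [RHS]ffunE; apply/eqP.
  have r_gt0 : (0 < r)%N by lia.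
  have /eqP := congr1 (fun f : fV => f v) b0.
  rewrite sum_ffunE ffunE => /eqP E.
  apply/eqP; rewrite -[LHS]r2 rsum.
  have -> : \sum_k (b k ^+ r *: t k) v ^+ r = \sum_k (b k *: u k) v.
    apply: eq_bigr => k _; rewrite !ffunE /GRing.scale /= !exprD !exprM !exprMn !r2.
    by ring.
  by rewrite E expr0n; case: (r) r_gt0.
pose D := wt j0.
have oD : is_order q K Kinv D.
  by apply: large_order => //; rewrite /D /wt; lia.
have tB j : t j \in B (wt j).+1.
  apply: below_le (mem_mono q_gt1 size_R K_gt0 KinvP curve_eq _ _) _.
  have := wtE j.1; have := wtE j.2; rewrite /wt => <- <-.
  by rewrite ltnS eq_leq //; ring.
have [_ [c c0' tD]] :=
  mono_reduce q_gt1 size_R K_gt0 KinvP curve_eq (i j0.1 * r + i j0.2) (a j0.1 * r + a j0.2).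
have ED : (q * (a j0.1 * r + a j0.2) + K * (i j0.1 * r + i j0.2) = D)%N.
  by rewrite /D /wt -!wtE; ring.
rewrite ED in tD.
suff /(card_curve_le q_gt1 size_R K_gt0 KinvP curve_eq zy_inj oD) : 
    mono_of z y q K Kinv D \in B D.
  apply/negP; rewrite -ltnNge; apply: leq_ltn_trans V_gt.
  have lt1 : (j0.1 < r + c0 + 2)%N := ltn_ord j0.1; have lt2 := ltn_ord j0.2.
  have h1 : (r * (c0 + j0.1) <= r * (c0 + (r + c0 + 1)))%N.
    rewrite leq_mul2l leq_add2l; apply/orP; right.
    lia.
  have h2 : (c0 <= c0 * r)%N by rewrite leq_pmulr //; lia.
  rewrite /D /wt -mulnn.
  by apply: leq_trans (leq_add h1 (leq_add (leqnn c0) (ltnW lt2))) _; move: h2; clear; lia.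
have {}t0 : t j0 = - (b j0 ^- r *: \sum_(j | j != j0) b j ^+ r *: t j).
  have bj0r : b j0 ^+ r != 0 by rewrite expf_neq0.
  apply: (scalerI bj0r); rewrite scalerN scalerA mulfV // scale1r.
  by move: t0; rewrite (bigD1 j0) //= => /eqP; rewrite addr_eq0 => /eqP ->.
suff : c *: mono_of z y q K Kinv D \in B D by rewrite rpredZeq (negbTE c0').
rewrite -[c *: _](addrNK (t j0)) -opprB rpredD ?rpredN //.
rewrite t0 rpredN rpredZ // rpred_sum // => j ne_j.
have [->|bj] := eqVneq (b j) 0.
  by rewrite expr0n (gtn_eqF (leq_ltn_trans _ r_gt)) ?scale0r ?mem0v.
rewrite rpredZ //; apply: below_le (tB j) _.
have := max_j0 j bj; rewrite /= leq_eqVlt => /orP[/eqP Ewt|//].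
(* Orders determine the pair of indices since the second index is less than r. *)
case/eqP: ne_j; case: j j0 Ewt {bj bj0 max_j0 t0 D oD tD ED} => [x1 x2] [w1 w2] /=.
rewrite /wt /= => E; have lt1 := ltn_ord x2; have lt2 := ltn_ord w2.
have E1 : x1 = w1 :> nat.
  case: (ltngtP x1 w1) => // lt; have := leq_mul (leqnn r) lt; lia.
by congr (_, _); apply: val_inj => //=; rewrite E1 in E; lia.
Qed.

(** A bound of the form r^2 + O(r) valid for all r: for small r the trivial
bound r^4 is absorbed in the constant, which depends on q and K only. *)
Lemma card_curve :
  (#|V| <= r ^ 2 + ((3 * (K * q) + 4) + (2 * (K * q) + 3) ^ 3) * r)%N.
Proof.
have [le|/card_curve_large/leq_trans->//] := leqP r (2 * (K * q) + 3); last first.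
  by rewrite leq_add2l leq_mul2r leq_addr orbT.
have leV : (#|V| <= #|{: L * L}|)%N.
  apply: (@leq_card _ _ (fun v => (z v, y v))) => u v [zuv yuv]; exact: zy_inj.
apply: leq_trans leV _; rewrite card_prod card_L.
apply: leq_trans (leq_addl _ _); rewrite mulnDl; apply: leq_trans (leq_addl _ _).
by rewrite -expnD -[(2 + 2)%N]/(3 + 1)%N expnD expn1 leq_mul // leq_exp2r.
Qed.

End StepanovBombieri.

(** * Newton identities and growth of power sums *)

Section PowerSums.

(** Bernoulli's inequality; it makes a geometric progression of ratio greater
than 1 exceed any bound. *)
Lemma bernoulli (x : algC) m : 1 <= x -> 1 + m%:R * (x - 1) <= x ^+ m.
Proof.
move=> x1; elim: m => [|m IH]; first by rewrite mul0r addr0 expr0.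
rewrite exprS; apply: le_trans (ler_wpM2l (le_trans ler01 x1) IH).
rewrite -subr_ge0 (_ : _ - _ = m%:R * (x - 1) ^+ 2); last by rewrite -natr1; ring.
by rewrite mulr_ge0 ?ler0n // exprn_ge0 // subr_ge0.
Qed.

Lemma geometric_le (x rho b c : algC) : 0 <= x -> 0 <= rho -> 0 < c ->
  (forall m, c * x ^+ m <= b * rho ^+ m) -> x <= rho.
Proof.
move=> x0 rho0 c0 le_m; rewrite real_leNgt ?ger0_real //; apply/negP => lt_x.
have rho_gt0 : 0 < rho.
  rewrite lt0r rho0 andbT; apply/eqP => rhoE.
  have : 0 < c * x by rewrite mulr_gt0 // -rhoE.
  by move/lt_le_trans/(_ (le_m 1)); rewrite rhoE expr1 mulr0 ltxx.
have y1 : 1 < x / rho by rewrite ltr_pdivlMr // mul1r.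
have le_y m : c * (x / rho) ^+ m <= b.
  by rewrite expr_div_n mulrA ler_pdivrMr ?exprn_gt0.
have y1' : 0 < c * (x / rho - 1) by rewrite mulr_gt0 // subr_gt0.
have b0 : 0 <= b by apply: le_trans (le_y 0); rewrite expr0 mulr1 ltW.
have /archi_boundP : 0 <= b / (c * (x / rho - 1)) by rewrite divr_ge0 // ltW.
set m := Num.bound _; rewrite ltr_pdivrMr // => lt_b.
have : m%:R * (c * (x / rho - 1)) <= c * (x / rho) ^+ m.
  rewrite mulrCA ler_pM2l //; apply: le_trans (bernoulli m (ltW y1)).
  by rewrite lerDr ler01.
by move/(lt_le_trans lt_b)/lt_le_trans/(_ (le_y m)); rewrite ltxx.
Qed.

(** A combination of shifted power sums, with the coefficients of a Lagrange
interpolation polynomial at the distinct entries of s, isolates a nonzero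
multiple of the m-th power of one entry. *)
Lemma power_sums_growth (s : seq algC) (b rho : algC) : 0 <= rho ->
  (forall m, `|\sum_(w <- s) w ^+ m| <= b * rho ^+ m) ->
  forall w, w \in s -> `|w| <= rho.
Proof.
move=> rho0 le_m w0 w0s.
(* A is a multiple of the Lagrange polynomial of w0 with respect to the other entries. *)
pose A : {poly algC} := \prod_(w <- undup s | w != w0) ('X - w%:P).
have Aw w : w \in s -> w != w0 -> A.[w] = 0.
  move=> ws ne; apply/eqP; rewrite horner_prod prodf_seq_eq0; apply/hasP.
  by exists w; rewrite ?mem_undup // ne !hornerE subrr eqxx.
have Aw0 : A.[w0] != 0.
  rewrite horner_prod prodf_seq_neq0; apply/allP => w _; apply/implyP => ne.
  by rewrite !hornerE subr_eq0 eq_sym.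
have E m : \sum_(l < size A) A`_l * (\sum_(w <- s) w ^+ (m + l)) =
           (count_mem w0 s)%:R * A.[w0] * w0 ^+ m.
  under eq_bigr => l _ do rewrite mulr_sumr.
  rewrite exchange_big /= (eq_big_seq (fun w => if w == w0 then A.[w0] * w0 ^+ m else 0)).
    by rewrite -big_mkcond /= big_const_seq iter_addr_0 -mulrA mulr_natl; congr (_ *+ _); apply: eq_count.
  move=> w ws /=; transitivity (A.[w] * w ^+ m).
    by rewrite horner_coef mulr_suml; apply: eq_bigr => l _; rewrite exprD; ring.
  by case: eqVneq => [->|/(Aw w ws)->] //; rewrite mul0r.
apply: (@geometric_le _ _ (\sum_(l < size A) `|A`_l| * (b * rho ^+ l))
          `|(count_mem w0 s)%:R * A.[w0]|) => // [|m].
  by rewrite normr_gt0 mulf_neq0 // pnatr_eq0 -lt0n -has_count has_pred1.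
rewrite -normrX -normrM -E (le_trans (ler_norm_sum _ _ _)) // mulr_suml ler_sum // => l _.
by rewrite normrM -mulrA ler_wpM2l // -mulrA -exprD addnC le_m.
Qed.

Lemma newton_identity (A : comNzRingType) (s : seq A) m (e := \prod_(w <- s) (1 - w *: 'X)) :
  \sum_(i < m.+1) (\sum_(w <- s) w ^+ i.+1) * e`_(m - i) = - (m.+1%:R * e`_m.+1).
Proof.
rewrite {}/e; elim: s m => [|w s IH] m.
  rewrite big_nil coef1 /= mulr0 oppr0 big1 // => i _.
  by rewrite big_nil mul0r.
rewrite big_cons; set e := \prod_(_ <- _) _ in IH *.
have eE j : ((1 - w *: 'X) * e)`_j = e`_j - w * (if j is j'.+1 then e`_j' else 0).
  by rewrite mulrBl mul1r coefB -scalerAl coefZ coefXM; case: j.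
under eq_bigr => i _ do rewrite big_cons eE mulrDl [X in _ + X]mulrBr.
rewrite !big_split /= sumrN IH eE.
have -> : \sum_(i < m.+1) (\sum_(x <- s) x ^+ i.+1) *
   (w * (if (m - i)%N is j.+1 then e`_j else 0)) = - (w * (m%:R * e`_m)).
  case: m => [|m].
    by rewrite big_ord_recr big_ord0 /= !mulr0 mul0r !mulr0 oppr0 addr0.
  rewrite big_ord_recr /= subnn !mulr0 addr0 -[in RHS]mulrN -IH mulr_sumr.
  by apply: eq_bigr => i _; rewrite (subSn (ltn_ord i : (i <= m)%N)) mulrCA.
have -> : \sum_(i < m.+1) w ^+ i.+1 *
   (e`_(m - i) - w * (if (m - i)%N is j.+1 then e`_j else 0)) = w * e`_m.
  elim: m {IH} => [|m IH].
    by rewrite big_ord_recr big_ord0 /= mulr0 subr0 add0r expr1.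
  rewrite big_ord_recl /= subn0 expr1.
  under eq_bigr => i _ do rewrite /bump /= add1n subSS exprS -mulrA.
  by rewrite -mulr_sumr IH; ring.
rewrite -natr1; ring.
Qed.

(** The sequence S is determined recursively by c, and the negated power sums
of the inverse roots of the polynomial with coefficients c satisfy the same
recursion. *)
Lemma newton_inversion (c S : nat -> algC) k :
    c 0 = 1 -> (forall j, (k < j)%N -> c j = 0) ->
    (forall m, m.+1%:R * c m.+1 = \sum_(i < m.+1) S i.+1 * c (m - i)%N) ->
  exists2 s : seq algC, (size s <= k)%N &
    forall m, S m.+1 = - \sum_(w <- s) w ^+ m.+1.
Proof.
move=> c0 ck cS; pose e := \poly_(j < k.+1) c j.
have eE j : e`_j = c j by rewrite coef_poly ltnS; case: leqP => // /ck.
have [t Et] := closed_field_poly_normal e.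
have e0 : e != 0.
  apply/eqP => /(congr1 (fun p : {poly _} => p`_0)).
  by rewrite eE c0 coef0 => /eqP; rewrite oner_eq0.
have t0 z : z \in t -> z != 0.
  move=> zt; apply/eqP => z0; have : root e z.
    by rewrite Et rootZ ?lead_coef_eq0 // root_prod_XsubC.
  by rewrite z0 /root horner_coef0 eE c0 oner_eq0.
(* c 0 = 1 makes the roots nonzero and the polynomial equal to the product of the
   factors 1 - X / z. *)
exists [seq z^-1 | z <- t].
  rewrite size_map -ltnS -(size_prod_XsubC t id).
  by rewrite -(size_scale _ (_ : lead_coef e != 0)) ?lead_coef_eq0 // -Et size_poly.
have Ee : e = \prod_(w <- [seq z^-1 | z <- t]) (1 - w *: 'X).
  have : exists2 a, a != 0 & e = a *: \prod_(w <- [seq z^-1 | z <- t]) (1 - w *: 'X).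
    rewrite Et big_map; exists (lead_coef e * \prod_(z <- t) - z).
      by rewrite mulf_neq0 ?lead_coef_eq0 // prodf_seq_neq0; apply/allP=> z /t0; rewrite oppr_eq0.
    rewrite -scalerA; congr (_ *: _).
    elim: t t0 {Et} => [|z t IH] t0; first by rewrite !big_nil scale1r.
    rewrite !big_cons IH => [|x xt]; last by rewrite t0 // inE xt orbT.
    rewrite -scalerAr [- z * _]mulrC -scalerA; congr (_ *: _).
    rewrite scalerAl; congr (_ * _); rewrite scalerBr scalerA mulNr mulfV; last first.
      by rewrite t0 // inE eqxx.
    by rewrite !scaleNr scale1r alg_polyC opprK addrC.
  case=> a a0 Ea; rewrite Ea; suff -> : a = 1 by rewrite scale1r.
  have := congr1 (fun p : {poly _} => p.[0]) Ea.
  rewrite hornerZ horner_prod big1 ?mulr1 => [|w _]; last by rewrite !hornerE ?mulr0 ?subr0.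
  by rewrite horner_coef0 eE c0.
elim/ltn_ind => m IH.
have NI : \sum_(i < m.+1) (\sum_(w <- [seq z^-1 | z <- t]) w ^+ i.+1) * c (m - i)%N =
          - (m.+1%:R * c m.+1).
  rewrite -[c m.+1]eE [e]Ee -newton_identity -Ee.
  by apply: eq_bigr => i _; rewrite -[c _]eE.
move/eqP: NI; rewrite cS -addr_eq0 addrC => /eqP.
rewrite -big_split big_ord_recr /= subnn c0 big1 ?add0r => [|i _].
  by rewrite !mulr1 => /eqP; rewrite addr_eq0 => /eqP.
by rewrite IH // mulNr addNr.
Qed.

End PowerSums.

(** * Power sums of the roots of a polynomial *)

Section PolyPowerSums.

Variable F : fieldType.
Implicit Types (f g : {poly F}) (i j : nat).

(** The i-th power sum of the roots of f, read off the expansion of f'/f at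
infinity: the coefficient of X^(-i-1) in f'/f is the constant term of the
quotient of X^(i+1) f' by f.  This avoids splitting fields and shows
additivity in f at once. *)
Definition power_sum f i := (('X^(i.+1) * f^`()) %/ f)`_0.

Lemma power_sumM f g i : f != 0 -> g != 0 -> power_sum (f * g) i = power_sum f i + power_sum g i.
Proof.
move=> f0 g0; rewrite /power_sum derivM mulrDr divpD coefD mulrA divp_pmul2r //.
by congr (_ + _); rewrite mulrCA divp_pmul2l.
Qed.

Lemma power_sum_XsubC (b : F) i : power_sum ('X - b%:P) i = b ^+ i.
Proof.
rewrite /power_sum derivXsubC mulr1.
have -> : 'X^(i.+1) = (\sum_(j < i.+1) 'X^(i - j) * b%:P ^+ j) * ('X - b%:P) + (b ^+ i.+1)%:P.
  by rewrite mulrC rmorphXn -subrXX subrK.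
rewrite divp_addl_mul_small ?size_XsubC ?size_polyC; last by case: (_ != 0).
rewrite coef_sum (bigD1 (Ordinal (ltnSn i))) //= subnn mul1r -rmorphXn coefC eqxx.
rewrite big1 ?addr0 // => j ne; rewrite -rmorphXn coefMC coefXn.
suff /ltn_eqF-> : (0 < i - j)%N by rewrite mul0r.
rewrite subn_gt0 ltn_neqAle -ltnS ltn_ord andbT.
by apply: contra ne => /eqP E; apply/eqP/val_inj.
Qed.

Lemma power_sum1 i : power_sum 1 i = 0.
Proof. by rewrite /power_sum -polyC1 derivC mulr0 div0p coef0. Qed.

Lemma power_sum_prod (s : seq F) i :
  power_sum (\prod_(b <- s) ('X - b%:P)) i = \sum_(b <- s) b ^+ i.
Proof.
elim: s => [|b s IH]; first by rewrite !big_nil power_sum1.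
rewrite !big_cons power_sumM ?polyXsubC_eq0 ?power_sum_XsubC ?IH //.
by rewrite monic_neq0 ?monic_prod_XsubC.
Qed.

Lemma coef_mul_top (a b : {poly F}) m n : (size a <= m.+1)%N -> (size b <= n.+1)%N ->
  (a * b)`_(m + n) = a`_m * b`_n.
Proof.
move=> sa sb; rewrite coefM; have lt_m : (m < (m + n).+1)%N by lia.
rewrite (bigD1 (Ordinal lt_m)) //= addKn big1 ?addr0 // => i ne.
case: (ltngtP i m) => [lt|gt|E]; last by case/eqP: ne; apply/val_inj.
  by rewrite [b`__]nth_default ?mulr0 //; apply: leq_trans sb _; move: lt; clear; lia.
by rewrite nth_default ?mul0r //; apply: leq_trans sa _.
Qed.

(** Newton's identities in differential form: changing the coefficient of
X^(deg f - i), and lower ones arbitrarily, leaves the power sums of index less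
than i unchanged and moves the i-th one by -i times the change. *)
Lemma power_sum_perturb f g i l : f \is monic -> g \is monic -> size g = size f ->
  (i < size f)%N -> (size (g - f)%R <= size f - i)%N -> (l <= i)%N ->
  power_sum g l = power_sum f l - (l%:R * (g - f)`_((size f).-1 - i)) *+ (l == i).
Proof.
move=> mf mg szg lt_i szgf li.
have f0 := monic_neq0 mf; have g0 := monic_neq0 mg.
rewrite /power_sum; set A := _ %/ f; set B := _ %/ g.
set j := (size f).-1; have Ej : size f = j.+1 by rewrite /j; case: size lt_i.
clearbody j; have le_ij : (i <= j)%N by rewrite -ltnS -Ej.
have [d Ed] : {d : {poly F} | d = g - f} by exists (g - f).
rewrite -Ed in szgf *.
have EA := divp_eq ('X^(l.+1) * f^`()) f; have EB := divp_eq ('X^(l.+1) * g^`()) g.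
rewrite -/A in EA; rewrite -/B in EB; set rA := _ %% f in EA; set rB := _ %% g in EB.
have szA : (size rA <= j)%N by rewrite -ltnS -Ej ltn_modp.
have szB : (size rB <= j)%N by rewrite -ltnS -Ej -szg ltn_modp.
(* A and B are the quotients whose constant terms are compared; the identity below
   shows that f * (B - A) has degree at most deg f, so B - A is a constant. *)
have E : f * (B - A) = 'X^(l.+1) * d^`() - d * B + (rA - rB).
  have -> : rA = 'X^(l.+1) * f^`() - A * f by rewrite EA; ring.
  have -> : rB = 'X^(l.+1) * g^`() - B * g by rewrite EB; ring.
  by rewrite Ed derivB; ring.
have szB' : (size B <= l.+1)%N.
  rewrite size_divp // szg Ej /=.
  apply: leq_trans (leq_sub2r _ (size_polyMleq _ _)) _.
  rewrite size_polyXn.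
  have : (size g^`() <= j)%N by rewrite -ltnS -Ej -szg lt_size_deriv.
  by lia.
have Bl : B`_l = j%:R.
  have := congr1 (fun p : {poly F} => p`_(l + j)) EB.
  rewrite coefD [(B * g)`_ _]coef_mul_top ?szg ?Ej //.
  rewrite [rB`__]nth_default; last exact: leq_trans szB (leq_addl _ _).
  rewrite addr0 (_ : g`_j = 1) ?mulr1 => [<-|]; last first.
    by have := monicP mg; rewrite /lead_coef szg Ej.
  rewrite coefXnM; case: (posnP j) => [j0|j_gt0].
    by rewrite j0 addn0 ltnSn.
  have -> : (l + j < l.+1)%N = false by lia.
  rewrite coef_deriv (_ : (l + j - l.+1).+1 = j)%N; last by lia.
  by have := monicP mg; rewrite /lead_coef szg Ej /= => ->.
have szd' : (size d^`() <= j - i)%N.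
  have [->|d0] := eqVneq d 0; first by rewrite deriv0 size_poly0.
  by have := lt_size_deriv d0; lia.
have szd : (size ('X^(l.+1) * d^`() - d * B + (rA - rB))%R <= j.+1)%N.
  apply: leq_trans (size_polyD _ _) _; rewrite geq_max; apply/andP; split.
    apply: leq_trans (size_polyD _ _) _; rewrite geq_max size_polyN; apply/andP; split.
      apply: leq_trans (size_polyMleq _ _) _; rewrite size_polyXn; clear - szd' le_ij li; lia.
    apply: leq_trans (size_polyMleq _ _) _; rewrite -subn1 leq_subLR.
    by apply: leq_trans (leq_add szgf szB') _; rewrite Ej; clear - le_ij li; lia.
  apply: leq_trans (size_polyD _ _) _; rewrite geq_max size_polyN.
  by rewrite !leqW.
have szBA : (size (B - A)%R <= 1)%N.
  have [->|BA0] := eqVneq (B - A) 0; first by rewrite size_poly0.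
  by move: szd; rewrite -E size_mul // Ej addSn /= -addn1 leq_add2l.
have := congr1 (fun p : {poly F} => p`_(j + 0)) E.
rewrite coef_mul_top ?Ej // (_ : f`_j = 1) ?mul1r; last first.
  by have := monicP mf; rewrite /lead_coef Ej.
rewrite coefB => EBA; rewrite -[B`_0](subrK A`_0) EBA addrC; congr (_ + _).
rewrite addn0 coefD [(rA - rB)`_j]nth_default ?addr0; last first.
  by apply: leq_trans (size_polyD _ _) _; rewrite geq_max size_polyN szA szB.
rewrite coefB coefXnM coef_deriv.
case: eqVneq => [Eli|ne_li]; rewrite ?mulr0n ?mulr1n; last first.
  have lt_li : (l < i)%N by rewrite ltn_neqAle ne_li.
  rewrite oppr0 (_ : (if _ then _ else _) = 0); last first.
    case: ltnP => // le_lj; rewrite [d`__]nth_default ?mul0rn //.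
    by apply: leq_trans szgf _; rewrite Ej; clear - lt_li le_lj; lia.
  rewrite sub0r nth_default ?oppr0 //.
  apply: leq_trans (size_polyMleq _ _) _; rewrite -subn1 leq_subLR.
  by apply: leq_trans (leq_add szgf szB') _; rewrite Ej; clear - le_ij lt_li; lia.
have Ej' : j = (j - i + l)%N by rewrite Eli subnK.
have -> : (d * B)`_j = d`_(j - i) * j%:R.
  rewrite -Bl [in LHS]Ej' coef_mul_top //.
  by apply: leq_trans szgf _; rewrite Ej subSn.
rewrite -Eli in le_ij *; case: ltnP => [lt|ge].
  have -> : j = l by apply/eqP; rewrite eqn_leq -ltnS lt.
  by rewrite subnn; ring.
by rewrite -subSn // subSS mulrnBr //; ring.
Qed.
End PolyPowerSums.

Lemma map_power_sum (F L : fieldType) (h : {rmorphism F -> L}) (f : {poly F}) i :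
  h (power_sum f i) = power_sum (map_poly h f) i.
Proof.
by rewrite /power_sum -coef_map map_divp rmorphM /= map_polyXn deriv_map.
Qed.

(** * Unique factorization and the logarithmic derivative *)

Section MonicPolynomials.

Variable F : finFieldType.
Implicit Types (f g P : {poly F}) (d e i j m : nat).

(** The monic polynomials of degree j as a list in the type of all
polynomials, so that sums over different degrees range over the same type. *)
Definition monics j : seq {poly F} :=
  [seq 'X^j + (r : {poly F}) | r : {poly_j F} <- enum {poly_j F}].
Definition irreds j : seq {poly F} := [seq f <- monics j | irreducibleb f].

Lemma mem_monics j f : (f \in monics j) = (f \is monic) && (size f == j.+1).
Proof.
apply/mapP/andP => [[r _ ->]|[mf /eqP sf]].
  have lt : (size (r : {poly F}) < size ('X^j : {poly F}))%N.
    by rewrite size_polyXn ltnS size_npoly.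
  by rewrite monicE lead_coefDl // size_polyDl // lead_coefXn size_polyXn.
have le : (size (f - 'X^j)%R <= j)%N.
  apply/leq_sizeP => l; rewrite coefB coefXn leq_eqVlt => /orP[/eqP<-|lt].
    by have := monicP mf; rewrite /lead_coef sf /= => ->; rewrite eqxx subrr.
  by rewrite nth_default ?sf // gtn_eqF // subrr.
by exists (npolyp j (f - 'X^j)); rewrite ?mem_enum // npolypK // addrC subrK.
Qed.

Lemma monics_uniq j : uniq (monics j).
Proof. by rewrite map_inj_uniq ?enum_uniq // => r s /addrI /val_inj. Qed.

Lemma mem_irreds j f :
  (f \in irreds j) = [&& irreducibleb f, f \is monic & size f == j.+1].
Proof. by rewrite mem_filter mem_monics. Qed.

Lemma irredsP j f : f \in irreds j ->
  [/\ irreducible_poly f, f \is monic, size f = j.+1 & (0 < j)%N].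
Proof.
rewrite mem_irreds => /and3P[/irreducibleP irr mf /eqP sf]; split=> //.
by have := irr.1; rewrite sf.
Qed.

Lemma irreds_uniq j : uniq (irreds j).
Proof. by rewrite filter_uniq ?monics_uniq. Qed.

Lemma monicsM i j f g : f \in monics i -> g \in monics j -> f * g \in monics (i + j).
Proof.
rewrite !mem_monics => /andP[mf /eqP sf] /andP[mg /eqP sg].
by rewrite monicMl // mg /= size_monicM ?monic_neq0 // sf sg addSn addnS.
Qed.

Lemma monics_cofactor i j f h : f \in monics i -> h \in monics (i + j) -> f %| h ->
  exists2 g, g \in monics j & h = f * g.
Proof.
rewrite !mem_monics => /andP[mf /eqP sf] /andP[mh /eqP sh] /dvdpP[g Eh].
exists g; last by rewrite mulrC.
have mg : g \is monic by rewrite -(monicMr _ mf) -Eh.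
rewrite mem_monics mg /=; move: sh; rewrite Eh size_monicM ?monic_neq0 // sf addnS /=.
by rewrite addnC -addnS => /addnI ->.
Qed.

Lemma monicsX i e f : f \in monics i -> f ^+ e \in monics (i * e).
Proof.
move=> fi; elim: e => [|e IH]; last by rewrite exprS mulnS monicsM.
by rewrite muln0 expr0 mem_monics monic1 size_poly1.
Qed.

Lemma irred_factor j f : f \in monics j -> (0 < j)%N ->
  exists i P, P \in irreds i /\ P %| f.
Proof.
elim/ltn_ind: j f => j IH f fj j_gt0.
have [irr|] := boolP (irreducibleb f).
  by exists j, f; rewrite mem_irreds irr dvdpp -mem_monics.
have [mf /eqP sf] := andP (etrans (esym (mem_monics _ _)) fj).
rewrite /irreducibleb sf ltnS j_gt0 /= negb_forall => /existsP[q].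
rewrite negb_imply -ltnNge -Pdiv.Idomain.dvdpE => /andP[qf sq].
have lq0 : lead_coef (q : {poly F}) != 0.
  by rewrite lead_coef_eq0 -size_poly_gt0 ltnW.
pose g := (lead_coef (q : {poly F}))^-1 *: (q : {poly F}).
have lq' : (lead_coef (q : {poly F}))^-1 != 0 by rewrite invr_eq0.
have sg : size g = size (q : {poly F}) by rewrite size_scale.
have gj : g \in monics (size g).-1.
  rewrite mem_monics monicE lead_coefZ mulVf // eqxx /= prednK //.
  by rewrite sg ltnW.
have lt : ((size g).-1 < j)%N.
  by rewrite sg -ltnS prednK ?(ltnW sq) // ltnS (leq_trans (size_npoly q)) // sf.
have [|i [P [Pi Pg]]] := IH _ lt g gj; first by rewrite sg -ltnS prednK // ltnW.
exists i, P; split=> //; apply: dvdp_trans Pg _.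
by rewrite dvdpZl.
Qed.

(** The inductive step of the factorization: multiplication by an irreducible
Q raises the multiplicity of Q by one and changes no other multiplicity. *)
Lemma irred_dvd_mul i j P Q g e : P \in irreds i -> Q \in irreds j -> (0 < e)%N ->
  (P ^+ e %| Q * g) = if P == Q then P ^+ e.-1 %| g else P ^+ e %| g.
Proof.
move=> Pi Qj e_gt0.
have [irrP mP _ _] := irredsP Pi; have [irrQ mQ _ _] := irredsP Qj.
case: eqVneq => [<-|PQ].
  by rewrite -{1}(prednK e_gt0) exprS dvdp_mul2l ?monic_neq0.
rewrite Gauss_dvdpr // coprimep_expl // irreducible_poly_coprime //.
apply: contra PQ => PQ; rewrite -eqp_monic //.
by apply: irrQ.2 PQ; rewrite neq_ltn irrP.1 orbT.
Qed.

Lemma sum_eq1 (T : eqType) (s : seq T) (x : T) (n : T -> nat) :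
  uniq s -> x \in s -> (\sum_(y <- s) (y == x) * n y = n x)%N.
Proof.
move=> us xs; rewrite (bigD1_seq x) //= eqxx mul1n big1 ?addn0 // => y ne.
by rewrite (negbTE ne).
Qed.

(** Unique factorization in counting form: P^e divides f for exactly as many
exponents e > 0 as the multiplicity of P.  The pairs (P, e) are arranged by
the degree i + 1 of P^e because this is the shape of the convolution in
[log_derivative]. *)
Lemma degree_factorization N j f : f \in monics j -> (j <= N)%N ->
  (\sum_(i < N) \sum_(d <- divisors i.+1) \sum_(P <- irreds d)
      d * (P ^+ (i.+1 %/ d)%N %| f)%R = j)%N.
Proof.
elim/ltn_ind: j f => j IH f fj le_jN.
case: (posnP j) => [j0|j_gt0].
  have f1 : f = 1.
    move: fj; rewrite j0 mem_monics => /andP[mf /eqP sf].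
    have /size_poly1P[c _ Ec] := introT eqP sf.
    by move: mf; rewrite Ec monicE lead_coefC => /eqP->.
  rewrite j0; apply: big1 => i _; rewrite big_seq; apply: big1 => d.
  rewrite -dvdn_divisors // => /dvdnP[e Ee]; rewrite big_seq; apply: big1 => P Pd.
  have [irr mP sP d_gt0] := irredsP Pd.
  rewrite f1 dvdp1 Ee mulnK //; case: e Ee => // e _.
  case: eqP => [s1|_]; last by rewrite muln0.
  have := size_exp P e.+1; rewrite s1 sP /= => /esym/eqP.
  by rewrite muln_eq0 gtn_eqF.
have [d0 [P0 [Pd0 P0f]]] := irred_factor fj j_gt0.
have [irr0 mP0 sP0 d0_gt0] := irredsP Pd0.
have P0d : P0 \in monics d0 by rewrite mem_monics mP0 sP0 eqxx.
have le_d0j : (d0 <= j)%N.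
  have [mf /eqP sf] := andP (etrans (esym (mem_monics _ _)) fj).
  by rewrite -ltnS -sP0 -sf dvdp_leq ?monic_neq0.
rewrite -(subnKC le_d0j) in fj; have [g gj Ef] := monics_cofactor P0d fj P0f.
have lt : (j - d0 < j)%N by lia.
have := IH _ lt g gj (leq_trans (ltnW lt) le_jN) => Eg.
(* e0 is one more than the multiplicity of P0 in g. *)
have [e0 [e0_gt0 e0_le e0P]] : exists e0, [/\ (0 < e0)%N, (d0 * e0 <= N)%N &
   forall e, (0 < e)%N -> ((P0 ^+ e.-1 %| g)%R = (P0 ^+ e %| g)%R + (e == e0) :> nat)%N].
  have gb e : P0 ^+ e %| g -> (d0 * e <= j - d0)%N.
    have [mg /eqP sg] := andP (etrans (esym (mem_monics _ _)) gj).
    have [_ /eqP sP0e] := andP (etrans (esym (mem_monics _ _)) (monicsX e P0d)).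
    by move/(dvdp_leq (monic_neq0 mg)); rewrite sP0e sg.
  have ex : exists e, ~~ (P0 ^+ e %| g).
    exists j.+1; apply/negP => /gb; apply/negP; rewrite -ltnNge.
    by apply: leq_trans lt _; rewrite (leq_trans (leqnSn j)) // leq_pmull.
  case: (ex_minnP ex) => e0 Ne0 min_e0.
  have e0_gt0 : (0 < e0)%N by case: e0 Ne0 {min_e0} => //; rewrite expr0 dvd1p.
  have lt_e0 e : (e < e0)%N -> P0 ^+ e %| g.
    by rewrite ltnNge => /negP ne; apply/negPn/negP => /min_e0.
  have ge_e0 e : (e0 <= e)%N -> (P0 ^+ e %| g) = false.
    by move=> le; apply: contraNF Ne0; apply/dvdp_trans/dvdp_exp2l.
  exists e0; split=> // [|e e_gt0].
    have /gb : P0 ^+ e0.-1 %| g by rewrite lt_e0 ?prednK.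
    by case: (e0) e0_gt0 => //= e1 _; rewrite mulnS; lia.
  case: (ltngtP e e0) => [lt1|lt1|->].
  - by rewrite !lt_e0 // (leq_ltn_trans (leq_pred e)).
  - by rewrite !ge_e0 ?(ltnW lt1) // -ltnS prednK.
  - by rewrite lt_e0 ?ge_e0 ?prednK.
(* i0 is the index at which passing from g to P0 * g adds d0. *)
pose i0 := (d0 * e0).-1; have Ei0 : i0.+1 = (d0 * e0)%N by rewrite prednK // muln_gt0 d0_gt0.
have lt_i0 : (i0 < N)%N by rewrite Ei0.
rewrite -[RHS](subnK le_d0j) -{1}Eg.
have -> : d0 = (\sum_(i < N) \sum_(d <- divisors i.+1) \sum_(P <- irreds d)
    ((i == Ordinal lt_i0) * ((d == d0) * ((P == P0) * d))))%N.
  rewrite (bigD1 (Ordinal lt_i0)) //= [X in (_ + X)%N]big1 ?addn0 => [|i ne].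
    pose n d := (\sum_(P <- irreds d) (P == P0) * d)%N.
    transitivity (n d0); first by rewrite /n (sum_eq1 (fun=> d0)) ?irreds_uniq.
    have d0_dv : d0 \in divisors i0.+1 by rewrite -dvdn_divisors // Ei0 dvdn_mulr.
    rewrite -[LHS](sum_eq1 n (divisors_uniq _) d0_dv); apply: eq_bigr => d _.
    by rewrite eqxx /n big_distrr; apply: eq_bigr => P _; rewrite mul1n.
  by rewrite (negbTE ne) big1 // => d _; rewrite big1.
rewrite -big_split; apply: eq_bigr => i _ /=; rewrite -big_split /=.
rewrite [LHS]big_seq [RHS]big_seq; apply: eq_bigr => d; rewrite -dvdn_divisors // => /dvdnP[e Ee].
rewrite -big_split /= [LHS]big_seq [RHS]big_seq; apply: eq_bigr => P Pd.
have [irr mP sP d_gt0] := irredsP Pd.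
rewrite Ef Ee mulnK //.
have e_gt0 : (0 < e)%N by case: e Ee.
rewrite (irred_dvd_mul _ Pd Pd0) //; case: eqVneq => [EP|ne].
  have Ed : d = d0 by apply: succn_inj; rewrite -sP EP sP0.
  rewrite EP e0P // mulnDr Ed eqxx !mul1n; congr (_ + _)%N.
  rewrite mulnC -val_eqE /=; congr (_ * _)%N; congr nat_of_bool.
  by rewrite -[RHS]eqSS Ei0 Ee Ed mulnC eqn_pmul2l.
by rewrite mul0n !muln0 addn0.
Qed.

Variable A : comNzRingType.
Variable lam : {poly F} -> A.
Hypothesis lamM : forall f g, f \is monic -> g \is monic -> lam (f * g) = lam f * lam g.

Definition monic_sum j : A := \sum_(f <- monics j) lam f.
(** The coefficient of T^m in T L'(T)/L(T), where L is the generating series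
of the sums [monic_sum]. *)
Definition prime_power_sum m : A :=
  \sum_(d <- divisors m) \sum_(P <- irreds d) d%:R * lam (P ^+ (m %/ d)).

(** Write the factor m + 1 on the left as the degree of f and decompose it
according to the prime powers that divide f. *)
Lemma log_derivative m :
  m.+1%:R * monic_sum m.+1 = \sum_(i < m.+1) prime_power_sum i.+1 * monic_sum (m - i)%N.
Proof.
transitivity (\sum_(f <- monics m.+1) \sum_(i < m.+1) \sum_(d <- divisors i.+1)
   \sum_(P <- irreds d) d%:R * (((P ^+ (i.+1 %/ d)%N %| f)%R)%:R * lam f)).
  rewrite mulr_sumr; apply: eq_big_seq => f fm.
  rewrite -{1}(degree_factorization fm (leqnn _)) natr_sum mulr_suml.
  apply: eq_bigr => i _; rewrite natr_sum mulr_suml.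
  apply: eq_bigr => d _; rewrite natr_sum mulr_suml.
  by apply: eq_bigr => P _; rewrite natrM mulrA.
rewrite exchange_big; apply: eq_bigr => i _ /=.
rewrite exchange_big mulr_suml; apply: eq_big_seq => d /=.
rewrite -dvdn_divisors // => /dvdnP[e Ee].
rewrite exchange_big mulr_suml; apply: eq_big_seq => P Pd /=.
rewrite -mulr_sumr -mulrA; congr (_ * _).
have [irr mP sP d_gt0] := irredsP Pd.
rewrite Ee mulnK // -/(monic_sum _).
have Pe : P ^+ e \in monics i.+1.
  by rewrite Ee mulnC monicsX // mem_monics mP sP eqxx.
have Emi : m.+1 = (i.+1 + (m - i))%N by have := ltn_ord i; lia.
transitivity (\sum_(f <- monics m.+1 | P ^+ e %| f) lam f).
  by rewrite [RHS]big_mkcond; apply: eq_bigr => f _; case: ifP; rewrite ?mul1r ?mul0r.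
rewrite -big_filter /monic_sum mulr_sumr.
rewrite (perm_big [seq P ^+ e * g | g <- monics (m - i)]) /=.
  rewrite big_map; apply: eq_big_seq => g; rewrite mem_monics => /andP[mg _].
  by rewrite lamM // monic_exp.
apply: uniq_perm; rewrite ?filter_uniq ?monics_uniq //.
  rewrite map_inj_uniq ?monics_uniq // => g h; apply: mulfI.
  by rewrite expf_neq0 ?monic_neq0.
move=> f; rewrite mem_filter; apply/andP/mapP => [[dv fm]|[g gm ->]].
  rewrite Emi in fm.
  by have [g gm ->] := monics_cofactor Pe fm dv; exists g.
by rewrite dvdp_mulr //; split=> //; have := monicsM Pe gm; rewrite -Emi.
Qed.

End MonicPolynomials.

(** * Finite extensions and conjugates *)

Section FiniteExtension.

Lemma card_finField_pchar (F : finFieldType) p : p \in [pchar F] ->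
  exists2 k, (0 < k)%N & #|F| = (p ^ k)%N.
Proof.
move=> pF; have := card_pgroup (abelem_pgroup (fin_ring_pchar_abelem pF)).
rewrite cardsT => E; exists (logn p #|F|) => //.
by rewrite lt0n; apply: contra_eq_neq E => ->; rewrite expn0 gtn_eqF ?finNzRing_gt1.
Qed.

Lemma frobD (F : finFieldType) (R : comNzRingType) (h : {rmorphism F -> R}) j :
  {morph (fun x : R => x ^+ (#|F| ^ j)) : x y / x + y}.
Proof.
have [p p_pr pF] := finPcharP F; have [k _ ->] := card_finField_pchar pF.
have pR : p \in [pchar R] by exact: rmorph_pchar pF.
move=> x y; apply: exprDn_pchar; rewrite -expnM; by rewrite pnatX pnatE // pR.
Qed.

(** The splitting field of X^(q^m) - X over F; its roots are the elements
fixed by the m-th power of the Frobenius, hence form a subfield. *)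
Lemma finField_extension (F : finFieldType) m : (0 < m)%N ->
  exists (L : finFieldType) (iota : {rmorphism F -> L}), #|L| = (#|F| ^ m)%N.
Proof.
move=> m_gt0; set Q := (#|F| ^ m)%N.
have q_gt1 : (1 < #|F|)%N := finNzRing_gt1 F.
have Q_gt1 : (1 < Q)%N by rewrite -(exp1n m) ltn_exp2r.
have Q1_gt0 : (0 < Q.-1)%N by rewrite -ltnS prednK // ltnW.
pose g (R : nzRingType) : {poly R} := 'X^Q - 'X.
have Dg R : g R = ('X^(Q.-1) - 1) * ('X - 0).
  by rewrite subr0 mulrBl mul1r -exprSr prednK // ltnW.
have /FinSplittingFieldFor[/= L splitLg] : g F != 0.
  by rewrite Dg monic_neq0 ?rpredM ?monicXsubC ?monicXnsubC.
rewrite [map_poly _ _]rmorphB rmorphXn /= map_polyX -/(g L) in splitLg.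
pose Fm := FinFieldExtType L.
exists Fm, (in_alg L : {rmorphism F -> Fm}).
have /finField_galois_generator[/= a _ Da]: (1 <= {:L})%VS by apply: sub1v.
pose Em := fixedSpace (a ^+ m)%g; rewrite dimv1 expn1 in Da.
have{splitLg} [zs DgL defL] := splitLg.
have Q0 : Q%:R = 0 :> L.
  have [p p_pr pF] := finPcharP F.
  have pL : p \in [pchar L] by rewrite pchar_lalg.
  have [k k_gt0 Ek] := card_finField_pchar pF.
  by rewrite /Q Ek -expnM natrX pcharf0 // expr0n muln_eq0 !gtn_eqF.
have Uzs: uniq zs.
  rewrite -separable_prod_XsubC -(eqp_separable DgL) Dg separable_root andbC.
  rewrite /root !hornerE subr_eq0 eq_sym expr0n gtn_eqF ?oner_eq0 //=.
  rewrite cyclotomic.separable_Xn_sub_1 // -subn1 natrB ?(ltnW Q_gt1) // Q0.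
  by rewrite sub0r oppr_eq0 oner_eq0.
suffices /eq_card->: Fm =i zs.
  apply: succn_inj; rewrite (card_uniqP _) //= -(size_prod_XsubC _ id).
  by rewrite -(eqp_size DgL) size_polyDl size_polyXn // size_polyN size_polyX.
have in_zs: zs =i Em.
  move=> z; rewrite -root_prod_XsubC -(eqp_root DgL) (sameP fixedSpaceP eqP).
  rewrite /root !hornerE subr_eq0 /= /Q; congr (_ == z).
  elim: (m) => [|i IHi]; first by rewrite gal_id.
  by rewrite expgSr expnSr exprM IHi galM ?Da ?memvf.
suffices defEm: Em = {:L}%VS by move=> z; rewrite in_zs defEm memvf.
apply/eqP; rewrite eqEsubv subvf -defL -[Em]subfield_closed agenvS //.
by rewrite subv_add sub1v; apply/span_subvP=> z; rewrite in_zs.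
Qed.

Lemma frobB (F : finFieldType) (R : comNzRingType) (h : {rmorphism F -> R}) j :
  {morph (fun x : R => x ^+ (#|F| ^ j)) : x y / x - y}.
Proof. by move=> x y; apply: (addIr (y ^+ (#|F| ^ j))); rewrite -(frobD h) !subrK. Qed.

End FiniteExtension.

Section Conjugates.

Variables (F L : finFieldType) (iota : {rmorphism F -> L}) (m : nat).
Local Notation q := #|F|.
Hypothesis m_gt0 : (0 < m)%N.
Hypothesis card_L : #|L| = (q ^ m)%N.
Local Notation "p ^i" := (map_poly iota p) (at level 2, format "p ^i").
Implicit Types (P Q : {poly F}) (x : L).

Lemma iota_frob (a : F) : iota a ^+ q = iota a.
Proof. by rewrite -rmorphXn expf_card. Qed.

Lemma frob_fixed x : x ^+ q = x -> exists a, x = iota a.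
Proof.
have q_gt1 : (1 < q)%N := finNzRing_gt1 F.
move=> xq; have [/codomP//|Nx] := boolP (x \in codom iota).
pose g : {poly L} := 'X^q - 'X.
have sg : size g = q.+1 by rewrite size_polyDl size_polyXn // size_polyN size_polyX.
have g0 : g != 0 by rewrite -size_poly_eq0 sg.
have := @max_poly_roots _ g (x :: codom iota) g0.
rewrite /= sg ltnS size_codom ltnn Nx /= map_inj_uniq ?enum_uniq; last exact: fmorph_inj.
suff -> : root g x && all (root g) (codom iota) by move=> /(_ isT isT).
rewrite /root !hornerE xq subrr eqxx; apply/allP => _ /codomP[a ->].
by rewrite !hornerE iota_frob subrr.
Qed.

Lemma frob_additive : {morph (fun x : L => x ^+ q) : x y / x + y}.
Proof. by have := frobD iota 1; rewrite expn1. Qed.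

Lemma iota_sum_frob (I : Type) (s : seq I) (f : I -> L) :
  (\sum_(i <- s) f i) ^+ q = \sum_(i <- s) f i ^+ q.
Proof.
apply: (big_morph (fun c : L => c ^+ q) frob_additive).
by rewrite expr0n gtn_eqF // ltnW // finNzRing_gt1.
Qed.

Lemma root_frob P x : root P^i x -> root P^i (x ^+ q).
Proof.
rewrite /root !horner_coef => /eqP/(congr1 (fun y => y ^+ q)).
rewrite iota_sum_frob expr0n gtn_eqF; last by rewrite ltnW // finNzRing_gt1.
move=> E; apply/eqP; rewrite -[RHS]E; apply: eq_bigr => i _.
by rewrite exprMn coef_map /= iota_frob -!exprM mulnC.
Qed.

Definition frob x := x ^+ q.

Fact frob_is_nmod_morphism : nmod_morphism frob.
Proof.
split; last exact: frob_additive.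
by rewrite /frob expr0n gtn_eqF // ltnW // finNzRing_gt1.
Qed.

Fact frob_is_monoid_morphism : monoid_morphism frob.
Proof. by split; [exact: expr1n | move=> x y; exact: exprMn]. Qed.

HB.instance Definition _ := GRing.isNmodMorphism.Build L L frob frob_is_nmod_morphism.
HB.instance Definition _ := GRing.isMonoidMorphism.Build L L frob frob_is_monoid_morphism.

(** The fixed field of the Frobenius is F. *)
Lemma frob_poly_descent (M : {poly L}) : map_poly frob M = M -> exists P, M = P^i.
Proof.
move=> frM; pose pre x := odflt 0 [pick a | iota a == x].
exists (\poly_(l < size M) pre M`_l); apply/polyP=> l.
rewrite coef_map coef_poly; case: ltnP => [_|le]; last by rewrite nth_default ?raddf0.
rewrite /pre; case: pickP => [a /eqP <- //|no].
have [a Ea] : exists a, M`_l = iota a.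
  by apply: frob_fixed; rewrite -[in RHS]frM coef_map.
by have := no a; rewrite Ea eqxx.
Qed.

Lemma common_root_dvdp (E : fieldType) (h : {rmorphism F -> E}) P Q (z : E) :
  irreducible_poly P -> root (map_poly h P) z -> root (map_poly h Q) z -> P %| Q.
Proof.
move=> irrP Pz Qz; apply: contraTT Qz; rewrite -irreducible_poly_coprime //.
by rewrite -(coprimep_map h) => /coprimep_root/(_ Pz); rewrite rootE.
Qed.

(** The characteristic polynomial of x over F. *)
Definition conj_poly x : {poly L} := \prod_(i < m) ('X - (x ^+ (q ^ i))%:P).

(** The product over one orbit of the Frobenius descends to F and is
irreducible there, since every factor over F has a root in the orbit and hence
the whole orbit.  The exponents of the remaining conjugates run through that
orbit m / d times. *)
Lemma conj_polyP x : exists d P, [/\ P \in irreds F d, d \in divisors m,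
  root P^i x, conj_poly x = (P ^+ (m %/ d))^i &
  exists2 s : seq L, uniq s & P^i = \prod_(y <- s) ('X - y%:P)].
Proof.
have x_m : x ^+ (q ^ m) = x by rewrite -card_L expf_card.
have ex : exists e, (0 < e)%N && (x ^+ (q ^ e) == x).
  by exists m; rewrite m_gt0 x_m eqxx.
case: (ex_minnP ex) => e /andP[e_gt0 /eqP xe] min_e.
pose c i := x ^+ (q ^ i).
have cS i : c i.+1 = c i ^+ q by rewrite /c expnSr exprM.
have cD i j : c (i + j)%N = c i ^+ (q ^ j) by rewrite /c expnD exprM.
have c_per i : c (i + e)%N = c i by rewrite addnC cD /c xe.
have c_mod i : c i = c (i %% e)%N.
  rewrite {1}(divn_eq i e) addnC; elim: (i %/ e)%N => [|k IH]; first by rewrite addn0.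
  by rewrite mulSn [(e + _)%N]addnC addnA c_per.
have e_dv : (e %| m)%N.
  rewrite /dvdn; apply/negPn/negP => ne; have := min_e (m %% e)%N.
  rewrite lt0n ne /= -/(c _) -c_mod /c x_m eqxx => /(_ isT).
  by rewrite leqNgt ltn_mod e_gt0.
pose s := [seq c i | i <- index_iota 0 e].
have us : uniq s.
  have inj i j : (i < j < e)%N -> c i = c j -> False.
    case/andP=> ij je Eij; have := min_e (i + (e - j))%N; rewrite -/(c _) cD Eij -cD.
    rewrite subnKC ?(ltnW je) // /c xe eqxx andbT addn_gt0.
    by rewrite subn_gt0 je orbT => /(_ isT); move: ij je; clear; lia.
  rewrite map_inj_in_uniq ?iota_uniq // => i j; rewrite !mem_index_iota /= => lti ltj Eij.
  by case: (ltngtP i j) => // lt; [case: (inj i j) | case: (inj j i)]; rewrite ?lt ?Eij.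
pose f i := 'X - (c i)%:P; pose M := \prod_(0 <= i < e) f i.
have EM : M = \prod_(y <- s) ('X - y%:P) by rewrite big_map.
have sM : size M = e.+1 by rewrite EM size_prod_XsubC size_map size_iota subn0.
have [P EP] : exists P, M = P^i.
  apply: frob_poly_descent; rewrite rmorph_prod /=.
  rewrite (eq_bigr (fun i => f i.+1)) => [|i _]; last first.
    by rewrite rmorphB /= map_polyX map_polyC /f cS.
  rewrite /M; case: (e) e_gt0 c_per => // e1 _ c_per.
  rewrite big_nat_recr //= [RHS]big_nat_recl //= mulrC /f.
  by rewrite -(c_per 0%N) add0n.
have rootc i : root P^i (c i).
  have c0 : root P^i (c 0).
    rewrite -EP EM root_prod_XsubC; apply/map_f; rewrite mem_index_iota.
    by rewrite leqnn.
  by elim: i => // i /root_frob; rewrite cS.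
have sP : size P = e.+1 by rewrite -sM EP size_map_poly.
have mP : P \is monic.
  by rewrite -(map_monic iota) -EP EM monic_prod_XsubC.
have irrP : irreducible_poly P.
  split=> [|Q sQ QP]; first by rewrite sP.
  rewrite /eqp QP -(dvdp_map iota) -EP EM uniq_roots_dvdp ?uniq_rootsE //.
  have [y ys Qy] : exists2 y, y \in s & root Q^i y.
    have := QP; rewrite -(dvdp_map iota) -EP EM => /dvdp_prod_XsubC[k Ek].
    have := eqp_size Ek; rewrite size_map_poly size_prod_XsubC.
    case Eks : (mask k s) => [|y t]; first by move=> E; rewrite E in sQ.
    move=> _; exists y; first by apply: (mem_mask (m := k)); rewrite Eks mem_head.
    by rewrite (eqp_root Ek) Eks root_prod_XsubC mem_head.
  have {ys}[i Ei] : exists i, y = c i by have /mapP[i _ ->] := ys; exists i.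
  have Qc t : root Q^i (c (i + t)%N).
    elim: t => [|t /root_frob]; first by rewrite addn0 -Ei.
    by rewrite addnS cS.
  apply/allP=> _ /mapP[j _ ->]; rewrite c_mod.
  have le : (i <= j + i * e)%N by rewrite (leq_trans _ (leq_addl _ _)) // leq_pmulr.
  by have := Qc (j + i * e - i)%N; rewrite subnKC // c_mod addnC modnMDl.
exists e, P; split.
- by rewrite mem_irreds mP sP eqxx !andbT; apply/irreducibleP.
- by rewrite -dvdn_divisors.
- exact: (rootc 0%N).
- rewrite rmorphXn /= -EP /conj_poly -(big_mkord xpredT f) -{1}(divnK e_dv).
  elim: (m %/ e)%N => [|k IH]; first by rewrite big_geq.
  rewrite exprS mulSn (big_cat_nat (n := e)) ?leq_addr //= -IH; congr (_ * _).
  rewrite -{1}[e]addn0 addnC big_addn addKn; apply: eq_bigr => i _.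
  by rewrite /f c_per.
- by exists s; rewrite // -EP.
Qed.

(** A root z in an extension of degree d satisfies z^(q^d) = z, so P divides
X^(q^m) - X, which splits in L. *)
Lemma irreds_root d P : P \in irreds F d -> (d %| m)%N -> exists x, root P^i x.
Proof.
move=> Pd /dvdnP[k Em]; have [irrP mP sP d_gt0] := irredsP Pd.
have [L0 dimL0 [z Pz _]] := irredp_FAdjoin irrP; rewrite sP /= in dimL0.
have zd : z ^+ (q ^ d) = z.
  have c1 := @card_vspacef F (FinFieldExtType L0) (Vector.class L0).
  have c2 := @card_vspace F (FinFieldExtType L0) (Vector.class L0) fullv.
  by have := @expf_card (FinFieldExtType L0) z; rewrite -c1 c2 dimL0.
have zm : z ^+ (q ^ m) = z.
  rewrite Em; elim: (k) => [|l IH]; first by rewrite expn0 expr1.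
  by rewrite mulSn expnD exprM zd.
pose g (R : nzRingType) : {poly R} := 'X^(q ^ m) - 'X.
have map_g (E : fieldType) (h : {rmorphism F -> E}) : map_poly h (g F) = g E.
  by rewrite rmorphB rmorphXn /= map_polyX.
have : P %| g F.
  apply: (common_root_dvdp irrP Pz); rewrite map_g /root !hornerE zm subrr //.
rewrite -(dvdp_map iota) map_g /g -card_L finField_genPoly.
rewrite -big_enum => /dvdp_prod_XsubC[b Eb].
have := eqp_size Eb; rewrite size_map_poly sP size_prod_XsubC.
case Es : (mask b _) => [|y t]; first by move=> [E]; rewrite E in d_gt0.
by move=> _; exists y; rewrite (eqp_root Eb) Es root_prod_XsubC mem_head.
Qed.

Lemma irreds_common_root d e P Q x : P \in irreds F d -> Q \in irreds F e ->
  root P^i x -> root Q^i x -> P = Q /\ d = e.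
Proof.
move=> Pd Qe Px Qx; have [irrP mP sP _] := irredsP Pd; have [irrQ mQ sQ _] := irredsP Qe.
have EPQ : P = Q.
  apply/eqP; rewrite -eqp_monic // /eqp.
  by rewrite (common_root_dvdp irrP Px Qx) (common_root_dvdp irrQ Qx Px).
by split=> //; apply: succn_inj; rewrite -sP EPQ.
Qed.

Lemma irreds_split d P : P \in irreds F d -> (d %| m)%N ->
  exists2 s : seq L, uniq s & P^i = \prod_(y <- s) ('X - y%:P).
Proof.
move=> Pd dm; have [x Px] := irreds_root Pd dm.
have [e [Q [Qe _ Qx _ sQ]]] := conj_polyP x.
by have [-> _] := irreds_common_root Pd Qe Px Qx.
Qed.

(** Group the elements of L by their minimal polynomials: P of degree d
dividing m has d roots in L, and the characteristic polynomial of each is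
P^(m/d). *)
Lemma sum_conj (A : comNzRingType) (lam : {poly F} -> A) (g : L -> A) :
  (forall x Q, conj_poly x = Q^i -> g x = lam Q) ->
  \sum_x g x = prime_power_sum lam m.
Proof.
move=> gE; rewrite /prime_power_sum.
transitivity (\sum_(d <- divisors m) \sum_(P <- irreds F d) \sum_x (root P^i x)%:R * g x).
  apply/esym; under eq_bigr => d _ do rewrite exchange_big.
  rewrite exchange_big; apply: eq_bigr => x _ /=.
  have [d0 [P0 [Pd0 d0m P0x _ _]]] := conj_polyP x.
  under eq_bigr => d _ do rewrite -mulr_suml.
  rewrite -mulr_suml -[RHS]mul1r; congr (_ * _).
  rewrite (bigD1_seq d0) ?divisors_uniq //= (bigD1_seq P0) ?irreds_uniq //= P0x.
  have zero d P : P \in irreds F d -> P != P0 \/ d != d0 -> (root P^i x)%:R = 0 :> A.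
    move=> Pd ne; case: (boolP (root _ _)) => // Px.
    by have [EP Ed] := irreds_common_root Pd Pd0 Px P0x; case: ne; rewrite ?EP ?Ed eqxx.
  rewrite !big1_seq ?addr0 // => [d /andP[ne _]|P /andP[ne Pd]]; last by apply: zero Pd _; left.
  by rewrite big1_seq // => P /andP[_ Pd]; apply: zero Pd _; right.
apply: eq_big_seq => d; rewrite -dvdn_divisors // => dm; apply: eq_big_seq => P Pd.
have [s us Es] := irreds_split Pd dm; have [_ _ sP _] := irredsP Pd.
have ss : size s = d.
  by apply: succn_inj; rewrite -sP -(size_map_poly iota) Es size_prod_XsubC.
transitivity (\sum_(x in s) lam (P ^+ (m %/ d))).
  rewrite [RHS]big_mkcond; apply: eq_bigr => x _.
  have -> : root P^i x = (x \in s) by rewrite Es root_prod_XsubC.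
  case: ifP => xs; rewrite ?mul0r ?mul1r //; apply: gE.
  have Px : root P^i x by rewrite Es root_prod_XsubC.
  have [d0 [P0 [Pd0 d0m P0x -> _]]] := conj_polyP x.
  by have [-> ->] := irreds_common_root Pd Pd0 Px P0x.
by rewrite sumr_const (card_uniqP us) ss mulr_natl.
Qed.
End Conjugates.

(** * Fibers of the trace and of the norm *)

Section Fibers.

(** Equality holds throughout the estimate of #|D| by the sizes of the image
and of the fibers.  Both the additive and the multiplicative form of Hilbert's
theorem 90 follow, because the image and the fibers are sets of roots of
polynomials. *)
Lemma full_fibers (X T : finType) (D : {set X}) (S : {set T}) (h : X -> T) a b :
  {in D, forall x, h x \in S} -> (#|S| <= a)%N ->
  (forall t, #|[set x in D | h x == t]| <= b)%N -> #|D| = (a * b)%N ->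
  {in S, forall t, #|[set x in D | h x == t]| = b}.
Proof.
move=> hS leS leb cD t tS; apply/eqP; rewrite eqn_leq leb /= leqNgt; apply/negP => lt.
have : (#|D| < #|S| * b)%N.
  have -> : #|D| = (\sum_(t in S) #|[set x in D | h x == t]|)%N.
    rewrite -sum1_card (partition_big h (mem S)) //=; apply: eq_bigr => u _.
    by rewrite -sum1_card; apply: eq_bigl => x; rewrite inE.
  rewrite -sum_nat_const (bigD1 t) //= [X in (_ < X)%N](bigD1 t) //=.
  by rewrite -addSn leq_add // leq_sum.
by rewrite ltnNge cD leq_mul2r leS orbT.
Qed.

Variables (F L : finFieldType) (iota : {rmorphism F -> L}) (m : nat).
Local Notation q := #|F|.
Hypothesis m_gt0 : (0 < m)%N.
Hypothesis card_L : #|L| = (q ^ m)%N.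

Let q_gt1 : (1 < q)%N := finNzRing_gt1 F.

Lemma card_roots_le (p : {poly L}) n (D : {set L}) : p != 0 -> (size p <= n.+1)%N ->
  {in D, forall x, root p x} -> (#|D| <= n)%N.
Proof.
move=> p0 sp rD; rewrite cardE -ltnS; apply: leq_trans sp.
apply: max_poly_roots; rewrite ?enum_uniq //.
by apply/allP => x; rewrite mem_enum => /rD.
Qed.

Lemma artin_schreier_fiber (u : L) : \sum_(j < m) u ^+ (q ^ j) = 0 ->
  #|[set y : L | y ^+ q - y == u]| = q.
Proof.
move=> tr0; pose h (y : L) := y ^+ q - y.
pose S := [set v : L | \sum_(j < m) v ^+ (q ^ j) == 0].
have H : {in S, forall t, #|[set y in [set: L] | h y == t]| = q}.
  apply: (@full_fibers _ _ _ _ _ (q ^ m.-1)).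
  - move=> y _; rewrite inE /h -(big_mkord xpredT (fun j => (y ^+ q - y) ^+ (q ^ j))).
    rewrite (@telescope_sumr_eq _ 0 m (fun j => y ^+ (q ^ j))) //.
      by rewrite -card_L expf_card expn0 expr1 subrr.
    move=> j _; rewrite (frobD iota) -exprM -expnS; congr (_ + _).
    have /eqP := frobD iota j y (- y); rewrite subrr expr0n expn_eq0.
    by rewrite (gtn_eqF (ltnW q_gt1)) /= eq_sym addrC addr_eq0 => /eqP.
  - pose p : {poly L} := \sum_(j < m) 'X^(q ^ j).
    have pc : p`_(q ^ m.-1) = 1.
      rewrite coef_sum; case: (m) m_gt0 => // n _.
      rewrite big_ord_recr /= coefXn eqxx big1 ?add0r // => j _.
      by rewrite coefXn eqn_exp2l // gtn_eqF.
    apply: (@card_roots_le p).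
    + by apply: contra_eq_neq pc => ->; rewrite coef0 eq_sym oner_eq0.
    + apply: leq_trans (size_sum _ _ _) _; apply/bigmax_leqP => j _.
      by rewrite size_polyXn ltnS leq_exp2l // -ltnS prednK.
    + move=> v; rewrite inE /root horner_sum => /eqP E; apply/eqP; rewrite -[RHS]E.
      by apply: eq_bigr => j _; rewrite hornerXn.
  - move=> t; pose p : {poly L} := 'X^q - ('X + t%:P).
    have sp : size p = q.+1.
      rewrite size_polyDl ?size_polyXn // size_polyN.
      by rewrite size_polyDl size_polyX ?ltnS // size_polyC; case: (t != 0).
    apply: (@card_roots_le p); rewrite ?sp // -?size_poly_eq0 ?sp //.
    by move=> y; rewrite !inE /= /h /root !hornerE -subr_eq0 opprD addrA.
  - by rewrite cardsT card_L -expnSr prednK.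
rewrite -[RHS](H u) ?inE ?tr0 //.
by apply: eq_card => y; rewrite !inE.
Qed.

Lemma hilbert90_fiber (u : L) : u ^+ (\sum_(j < m) q ^ j) = 1 ->
  #|[set z : L | z ^+ q.-1 == u]| = q.-1.
Proof.
set E := (\sum_(j < m) q ^ j)%N => u1; pose h (z : L) := z ^+ q.-1.
have EE : (q ^ m).-1 = (E * q.-1)%N by rewrite predn_exp mulnC.
have q1_gt0 : (0 < q.-1)%N by rewrite -ltnS prednK // ltnW.
have E_gt0 : (0 < E)%N by rewrite /E; case: (m) m_gt0 => // n _; rewrite big_ord_recl.
have H : {in [set v : L | v ^+ E == 1],
    forall t, #|[set z in [set z : L | z != 0] | h z == t]| = q.-1}.
  apply: (@full_fibers _ _ _ _ _ E).
  - move=> z; rewrite !inE => z0; rewrite /h -exprM mulnC -EE.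
    apply/eqP/(mulfI z0); rewrite mulr1 -exprS prednK ?expn_gt0 ?(ltnW q_gt1) //.
    by rewrite -card_L expf_card.
  - apply: (@card_roots_le ('X^E - 1)).
    + by rewrite -size_poly_gt0 size_XnsubC.
    + by rewrite size_XnsubC.
    + by move=> v; rewrite inE /root !hornerE subr_eq0.
  - move=> t; apply: (@card_roots_le ('X^(q.-1) - t%:P)).
    + by rewrite -size_poly_gt0 size_XnsubC.
    + by rewrite size_XnsubC.
    + by move=> v; rewrite !inE /root !hornerE subr_eq0 => /andP[].
  - by rewrite -EE -card_L -(cardC1 (0 : L)); apply: eq_card => z; rewrite !inE.
rewrite -[RHS](H u) ?inE ?u1 //; apply: eq_card => z; rewrite !inE /h.
case: (eqVneq z 0) => [->|//] /=; rewrite expr0n gtn_eqF //=; apply/eqP => u0.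
by move: u1; rewrite -u0 expr0n gtn_eqF // => /eqP; rewrite eq_sym oner_eq0.
Qed.

End Fibers.

(** * Elements with prescribed trace and norm *)

Section NormTraceFibers.

Variables (F L : finFieldType) (iota : {rmorphism F -> L}) (s p : nat).
Local Notation q := #|F|.
Hypothesis s_gt0 : (0 < s)%N.
Hypothesis card_L : #|L| = (q ^ s.*2)%N.
Hypothesis pF : p \in [pchar F].
Variable xi : {poly F}.
Hypothesis xi0 : xi != 0.
Hypothesis lt_xi_p : (size xi < p)%N.

Let q_gt1 : (1 < q)%N := finNzRing_gt1 F.
Let m := s.*2.
Let r := (q ^ s)%N.
Let K := (size xi * q.-1)%N.

(** The constant of [card_curve] for the curve below; it depends on F and on
the degree of xi, not on the degree of the extension. *)
Definition curve_const := ((3 * (K * q) + 4) + (2 * (K * q) + 3) ^ 3)%N.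

Let A : {poly L} := map_poly iota ('X * xi).

(** If x and x0 have the same norm and A(x), A(x0) the same trace, then x = x0
z^(q-1) for q - 1 values of z, and A(x) - A(x0) = y^q - y for q values of y.
So q (q-1) points of the curve y^q - y = A(x0 z^(q-1)) - A(x0) correspond to
each x. *)
Lemma card_norm_trace_fiber (x0 : L) (D : {set L}) : x0 != 0 ->
  (forall x, x \in D -> [/\ x != 0,
      \sum_(j < m) A.[x] ^+ (q ^ j) = \sum_(j < m) A.[x0] ^+ (q ^ j) &
      x ^+ (\sum_(j < m) q ^ j) = x0 ^+ (\sum_(j < m) q ^ j)]) ->
  (#|D| * (q * q.-1) <= r ^ 2 + curve_const * r)%N.
Proof.
move=> x00 DP; have m_gt0 : (0 < m)%N by rewrite double_gt0.
have q1_gt0 : (0 < q.-1)%N by rewrite -ltnS prednK // ltnW.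
have card_L2 : #|L| = (r ^ 2)%N by rewrite card_L -expnM muln2.
pose R := (A - (A.[x0])%:P) \Po (x0 *: 'X^(q.-1)).
have RE z : R.[z] = A.[x0 * z ^+ q.-1] - A.[x0].
  by rewrite horner_comp !hornerE.
have sA : size A = (size xi).+1.
  by rewrite size_map_poly mulrC size_mulX.
have sA1 : size (A - (A.[x0])%:P)%R = (size xi).+1.
  rewrite size_polyDl sA // size_polyN ltnS.
  by apply: leq_trans (size_polyC_leq1 _) _; rewrite size_poly_gt0.
have sR : size R = K.+1.
  have := size_comp_poly (A - (A.[x0])%:P) (x0 *: 'X^(q.-1)).
  rewrite -/R sA1 size_scale // size_polyXn /=.
  have : (0 < size xi * q.-1)%N by rewrite muln_gt0 size_poly_gt0 xi0.
  by case: (size R) => [|n] /= lt E; [rewrite -E in lt | rewrite E].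
pose V := {v : L * L | v.2 ^+ q - v.2 == R.[v.1]}.
pose z (v : V) := (val v).1; pose y (v : V) := (val v).2.
have curve v : y v ^+ q = y v + R.[z v].
  by have /eqP <- := valP v; rewrite addrC subrK.
have zy u v : z u = z v -> y u = y v -> u = v.
  by rewrite /z /y => z1 y1; apply: val_inj; case: (val u) (val v) z1 y1 => [? ?] [? ?] /= -> ->.
have coK : coprime K q.
  have [e e_gt0 Eq] := card_finField_pchar pF.
  rewrite coprimeMl; apply/andP; split; last by rewrite coprimePn // ltnW.
  have p_pr := pcharf_prime pF.
  rewrite Eq coprime_pexpr // coprime_sym prime_coprime // gtnNdvd //.
  by rewrite size_poly_gt0.
have K_gt0 : (0 < K)%N by rewrite muln_gt0 size_poly_gt0 xi0.
have := card_curve q_gt1 sR K_gt0 coK curve zy card_L2 (frobD iota s).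
apply: leq_trans.
pose fib x := [set v : V | x0 * z v ^+ q.-1 == x].
have fibP x : x \in D -> #|fib x| = (q * q.-1)%N.
  move=> /DP[xn0 tr nm].
  have := hilbert90_fiber m_gt0 card_L (u := x / x0).
  rewrite expr_div_n nm divff ?expf_neq0 // => /(_ erefl) EZ.
  have := artin_schreier_fiber iota m_gt0 card_L (u := A.[x] - A.[x0]).
  have -> : \sum_(j < m) (A.[x] - A.[x0]) ^+ (q ^ j) = 0.
    under eq_bigr => j _ do rewrite (frobB iota).
    by rewrite sumrB tr subrr.
  move=> /(_ erefl) EY.
  transitivity (#|setX [set z : L | z ^+ q.-1 == x / x0]
                       [set y : L | y ^+ q - y == A.[x] - A.[x0]]|); last first.
    by rewrite cardsX EY EZ mulnC.
  rewrite -(card_imset _ val_inj); apply: eq_card => -[z1 y1].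
  have Ez (t : L) : (x0 * t ^+ q.-1 == x) = (t ^+ q.-1 == x / x0).
    by rewrite -[RHS](inj_eq (mulfI x00)) [x0 * (_ / _)]mulrC divfK.
  rewrite inE /= !inE; apply/imsetP/andP => [[[[z2 y2] vP]]|[zP yP]].
    rewrite inE /z /= => vx [-> ->]; move: vP; rewrite RE /= (eqP vx) => vP.
    by rewrite -Ez.
  rewrite -Ez in zP.
  have vP : (z1, y1).2 ^+ q - (z1, y1).2 == R.[(z1, y1).1] by rewrite RE (eqP zP).
  by exists (Sub (z1, y1) vP : V); rewrite ?inE.
have -> : (#|D| * (q * q.-1) = \sum_(x in D) \sum_(v : V) (x0 * z v ^+ q.-1 == x)%R)%N.
  rewrite -sum_nat_const; apply: eq_bigr => x /fibP <-.
  by rewrite -sum1_card big_mkcond; apply: eq_bigr => v _; rewrite inE; case: eqP.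
rewrite exchange_big.
have <- : (\sum_(v : V) 1 = #|{: V}|)%N by rewrite big_const iter_addn_0 mul1n.
apply: leq_sum => v _.
rewrite -big_mkcondr sum1_card -(card1 (x0 * z v ^+ q.-1)).
by apply: subset_leq_card; apply/subsetP => x; rewrite !inE eq_sym => /andP[].
Qed.
End NormTraceFibers.

(** * Mixed character sums over extensions of even degree *)

Section CharacterSums.

Variables (F : finFieldType) (p k : nat).
Local Notation q := #|F|.
Hypothesis pF : p \in [pchar F].
Hypothesis lt_kp : (k < p)%N.
Variables (psi chi : F -> algC).
Hypothesis psiD : forall x y, psi (x + y) = psi x * psi y.
Hypothesis psi_norm : forall x, `|psi x| = 1.
Hypothesis psi_sum : \sum_x psi x = 0.
Hypothesis chiM : forall x y, chi (x * y) = chi x * chi y.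
Hypothesis chi0 : chi 0 = 0.
Hypothesis chi_norm : forall x, `|chi x| <= 1.
Variable xi : {poly F}.
Hypothesis size_xi : (size xi <= k)%N.

(** The additive part depends on the first k power sums, weighted by the
coefficients of xi; encoding the frequency as a polynomial makes the finite
type of polynomials of size at most k the dual group. *)
Definition mixed_char (f : {poly F}) : algC :=
  psi (\sum_(i < k) xi`_i * power_sum f i.+1) * chi f`_0.

Lemma mixed_charM f g : f \is monic -> g \is monic -> mixed_char (f * g) = mixed_char f * mixed_char g.
Proof.
move=> mf mg; rewrite /mixed_char coef0M chiM mulrACA -psiD -big_split /=; congr (psi _ * _).
by apply: eq_bigr => i _; rewrite power_sumM ?monic_neq0 // mulrDr.
Qed.

Lemma iota_horner_frob (L : finFieldType) (iota : {rmorphism F -> L}) f (x : L) j :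
  (map_poly iota f).[x] ^+ (q ^ j) = (map_poly iota f).[x ^+ (q ^ j)].
Proof.
have frobS (I : finType) (h : I -> L) : (\sum_i h i) ^+ (q ^ j) = \sum_i h i ^+ (q ^ j).
  apply: (big_morph (fun c : L => c ^+ (q ^ j)) (frobD iota j)).
  by rewrite expr0n expn_eq0 (gtn_eqF (ltnW (finNzRing_gt1 F))).
rewrite !horner_coef frobS; apply: eq_bigr => l _.
rewrite exprMn coef_map /= -!exprM [(l * _)%N]mulnC; congr (_ * _).
rewrite -rmorphXn; congr (iota _); elim: j {frobS} => [|j IH]; first by rewrite expn0 expr1.
by rewrite expnS exprM expf_card.
Qed.

Section Even.

Hypothesis xi0 : xi != 0.
Variable s : nat.
Hypothesis s_gt0 : (0 < s)%N.

Let B := curve_const xi.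
Let r := (q ^ s)%N.

(** The fibers of (trace, norm) partition L^*, and M bounds the order of each
of them from above.  Subtracting the constant M does not change the character
sum, and the differences, all nonnegative, add up to q (q-1) M - |L^*| = B r +
1. *)
Lemma prime_power_sum_even_bound : `|prime_power_sum mixed_char s.*2| <= (B * r).+1%:R.
Proof.
set m := s.*2; have m_gt0 : (0 < m)%N by rewrite double_gt0.
have q_gt1 : (1 < q)%N := finNzRing_gt1 F.
have [L [iota card_L]] := finField_extension F m_gt0.
have [Q QE] : exists Q : L -> {poly F}, forall x, conj_poly F m x = map_poly iota (Q x).
  apply: (@fin_all_exists L (fun=> {poly F}) (fun x R => conj_poly F m x = map_poly iota R)) => x.
  by have [d [P [_ _ _ -> _]]] := conj_polyP iota m_gt0 card_L x; exists (P ^+ (m %/ d)).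
rewrite -(sum_conj m_gt0 card_L (g := fun x => mixed_char (Q x)) (iota := iota)); last first.
  by move=> x P EP; congr mixed_char; apply: (@map_poly_inj _ _ iota); rewrite -QE.
pose tau x := \sum_(i < k) xi`_i * power_sum (Q x) i.+1.
pose nu x := (Q x)`_0.
pose A := map_poly iota ('X * xi).
have tauE x : iota (tau x) = \sum_(j < m) A.[x] ^+ (q ^ j).
  have AE y : A.[y] = \sum_(i < k) iota xi`_i * y ^+ i.+1.
    rewrite /A rmorphM /= map_polyX hornerM hornerX (@horner_coef_wide _ k); last first.
      by rewrite size_map_poly.
    by rewrite mulr_sumr; apply: eq_bigr => i _; rewrite coef_map exprS mulrCA.
  under [RHS]eq_bigr => j _ do rewrite iota_horner_frob AE.
  rewrite rmorph_sum exchange_big; apply: eq_bigr => i _ /=.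
  rewrite rmorphM map_power_sum -QE -mulr_sumr; congr (_ * _).
  have -> : conj_poly F m x = \prod_(y <- [seq x ^+ (q ^ j) | j : 'I_m <- enum 'I_m]) ('X - y%:P).
    by rewrite big_map big_enum.
  by rewrite power_sum_prod big_map big_enum.
have nuE x : iota (nu x) = x ^+ (\sum_(j < m) q ^ j).
  rewrite /nu -coef_map -QE -horner_coef0 horner_prod.
  under eq_bigr => j _ do rewrite !hornerE.
  by rewrite prodrN card_ord -signr_odd odd_double expr0 mul1r -expr_sum.
have nu0 x : (nu x == 0) = (x == 0).
  rewrite -(fmorph_eq0 iota) nuE expf_eq0 andb_idl // => _.
  by case: (m) m_gt0 => // n _; rewrite big_ord_recl.
pose D (tc : F * F) := [set x | (tau x == tc.1) && (nu x == tc.2)].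
have fib tc : tc.2 != 0 -> (#|D tc| * (q * q.-1) <= r ^ 2 + B * r)%N.
  move=> c0; have [->|[x0]] := set_0Vmem (D tc); first by rewrite cards0 mul0n.
  rewrite inE => /andP[/eqP t0 /eqP n0].
  apply: (card_norm_trace_fiber s_gt0 card_L pF xi0 (leq_ltn_trans size_xi lt_kp) (x0 := x0)).
    by rewrite -nu0 n0.
  move=> x; rewrite inE => /andP[/eqP t1 /eqP n1].
  split; first by rewrite -nu0 n1.
    exact: etrans (esym (tauE x)) (etrans (congr1 iota (etrans t1 (esym t0))) (tauE x0)).
  exact: etrans (esym (nuE x)) (etrans (congr1 iota (etrans n1 (esym n0))) (nuE x0)).
pose e (tc : F * F) := psi tc.1 * chi tc.2.
have -> : \sum_x mixed_char (Q x) = \sum_(tc : F * F) #|D tc|%:R * e tc.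
  rewrite (partition_big (fun x => (tau x, nu x)) xpredT) //=; apply: eq_bigr => -[t c] _.
  rewrite mulr_natl -sumr_const; apply: eq_big => [x|x /eqP[<- <-]] //.
  by rewrite inE xpair_eqE.
have q1_gt0 : (0 < q.-1)%N by rewrite -ltnS prednK // ltnW.
have c0 : (q * q.-1)%:R != 0 :> algC by rewrite pnatr_eq0 -lt0n muln_gt0 ltnW.
(* The upper bound for the order of a fiber. *)
pose M : algC := (r ^ 2 + B * r)%:R / (q * q.-1)%:R.
have -> : \sum_(tc : F * F) #|D tc|%:R * e tc = \sum_(tc : F * F) (#|D tc|%:R - M) * e tc.
  under [RHS]eq_bigr => tc _ do rewrite mulrBl.
  rewrite sumrB -mulr_sumr -(pair_bigA _ (fun t c => psi t * chi c)) /=.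
  under [X in M * X]eq_bigr => t _ do rewrite -mulr_sumr.
  by rewrite -mulr_suml psi_sum mul0r mulr0 subr0.
have -> : (B * r).+1%:R = \sum_(tc : F * F | tc.2 != 0) (M - #|D tc|%:R).
  rewrite sumrB sumr_const.
  have -> : #|(fun tc : F * F => tc.2 != 0)| = (q * q.-1)%N.
    rewrite -(cardC1 (0 : F)) -[q in RHS]cardsT -[#|predC1 _|]cardsE -cardsX.
    by rewrite -cardsE; apply: eq_card => -[t c]; rewrite !inE.
  rewrite -[M *+ _]mulr_natr divfK //.
  have -> : \sum_(tc : F * F | tc.2 != 0) #|D tc|%:R = (r ^ 2).-1%:R :> algC.
    rewrite -natr_sum; congr _%:R.
    have -> : (r ^ 2).-1 = #|predC1 (0 : L)| by rewrite cardC1 card_L -expnM muln2.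
    rewrite -[RHS]sum1_card (partition_big (fun x => (tau x, nu x)) (fun tc => tc.2 != 0)) /=.
      apply: eq_bigr => -[t c] /= cn0; rewrite -sum1_card; apply: eq_bigl => x.
      rewrite !inE xpair_eqE -nu0; case: (tau x == t); rewrite ?andbF //=.
      by case: (eqVneq (nu x) c) => [->|_]; rewrite ?cn0 ?andbF.
    by move=> x; rewrite !inE nu0.
  have r_gt0 : (0 < r ^ 2)%N by rewrite !expn_gt0 (ltnW q_gt1).
  rewrite -natrB; last by rewrite (leq_trans (leq_pred _)) // leq_addr.
  by congr _%:R; move: r_gt0; case: (r ^ 2)%N => // n _ /=; clear; lia.
apply: le_trans (ler_norm_sum _ _ _) _.
rewrite [X in _ <= X]big_mkcond ler_sum // => tc _.
case: ifP => [c_n0|/negbFE/eqP c_0]; last by rewrite /e c_0 chi0 mulr0 mulr0 normr0.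
have le : #|D tc|%:R <= M.
  by rewrite ler_pdivlMr ?ltr0n ?muln_gt0 ?q1_gt0 ?(ltnW q_gt1) // -natrM ler_nat fib.
rewrite normrM distrC [`|M - _|]ger0_norm ?subr_ge0 // ler_piMr ?subr_ge0 //.
by rewrite normrM psi_norm mul1r.
Qed.

End Even.
End CharacterSums.

(** * The Riemann hypothesis for mixed character sums *)

Section RiemannHypothesis.

Variables (F : finFieldType) (p k : nat).
Local Notation q := #|F|.
Hypothesis pF : p \in [pchar F].
Hypothesis lt_kp : (k < p)%N.
Variables (psi chi : F -> algC).
Hypothesis psiD : forall x y, psi (x + y) = psi x * psi y.
Hypothesis psi_norm : forall x, `|psi x| = 1.
Hypothesis psi_sum : \sum_x psi x = 0.
Hypothesis chiM : forall x y, chi (x * y) = chi x * chi y.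
Hypothesis chi0 : chi 0 = 0.
Hypothesis chi1 : chi 1 = 1.
Hypothesis chi_norm : forall x, `|chi x| <= 1.
Variable xi : {poly F}.
Hypothesis size_xi : (size xi <= k)%N.

Local Notation lam := (mixed_char k psi chi xi).

Lemma psi_0 : psi 0 = 1.
Proof.
have psi0n0 : psi 0 != 0 by rewrite -normr_gt0 psi_norm ltr01.
by apply: (mulfI psi0n0); rewrite mulr1 -psiD addr0.
Qed.

Lemma psi_nontrivial : exists a, psi a != 1.
Proof.
apply/existsP; apply: contra_eqT psi_sum; rewrite negb_exists => /forallP all1.
rewrite (eq_bigr (fun=> 1)) => [|a _]; last by apply/eqP; rewrite -[_ == _]negbK.
by rewrite sumr_const pnatr_eq0 -lt0n (ltnW (finNzRing_gt1 F)).
Qed.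

Lemma monic_sum_0 : monic_sum lam 0 = 1.
Proof.
have E0 : perm_eq (monics F 0) [:: 1].
  apply: uniq_perm; rewrite ?monics_uniq // => f; rewrite inE mem_monics.
  apply/andP/eqP => [[mf /eqP sf]|->]; last by rewrite monic1 size_poly1.
  have /size_poly1P[c _ Ec] := introT eqP sf.
  by move: mf; rewrite Ec monicE lead_coefC => /eqP->.
rewrite /monic_sum (perm_big _ E0) big_seq1 /mixed_char coef1 eqxx chi1 mulr1.
by rewrite big1 ?psi_0 // => i _; rewrite power_sum1 mulr0.
Qed.

(** Reindexing the sum along h multiplies it by a. *)
Lemma monic_sum_shift j (h : {poly F} -> {poly F}) (a : algC) : injective h -> a != 1 ->
  (forall f, f \in monics F j -> h f \in monics F j /\ lam (h f) = a * lam f) ->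
  monic_sum lam j = 0.
Proof.
move=> hI a1 hP.
have : monic_sum lam j = a * monic_sum lam j.
  rewrite {1}/monic_sum (perm_big [seq h f | f <- monics F j]) /=.
    by rewrite big_map /monic_sum mulr_sumr; apply: eq_big_seq => f /hP[].
  have sub : {subset [seq h f | f <- monics F j] <= monics F j}.
    by move=> _ /mapP[f /hP[hf _] ->].
  have u : uniq [seq h f | f <- monics F j] by rewrite map_inj_uniq ?monics_uniq.
  rewrite perm_sym; apply: uniq_perm; rewrite ?monics_uniq //.
  by apply: (uniq_min_size u sub _).2; rewrite [leqRHS]size_map.
move/eqP; rewrite -subr_eq0 -{1}[monic_sum _ _]mul1r -mulrBl mulf_eq0 subr_eq0.
by rewrite eq_sym (negbTE a1) => /eqP.
Qed.

(** Move the coefficient of X^(j-i), where i - 1 is the degree of xi.  Among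
the power sums that occur with a nonzero coefficient only the i-th one
changes, and the constant term stays the same since i < j. *)
Lemma monic_sum_additive j : xi != 0 -> (k < j)%N -> monic_sum lam j = 0.
Proof.
move=> xi0 lt_kj; have [a a1] := psi_nontrivial.
set i := size xi; have i_gt0 : (0 < i)%N by rewrite size_poly_gt0.
have le_ik : (i <= k)%N by [].
pose c := lead_coef xi * i%:R.
have c0 : c != 0.
  rewrite mulf_neq0 ?lead_coef_eq0 // -(dvdn_pcharf pF) gtnNdvd //.
  exact: leq_ltn_trans le_ik lt_kp.
pose d := - a / c.
apply: (@monic_sum_shift _ (fun f => f + d *: 'X^(j - i)) (psi a)) => // [f g /addIr //|f].
move=> fj; have /andP[mf /eqP sf] := etrans (esym (mem_monics j f)) fj.
set g := f + _.
have sd : (size (d *: 'X^(j - i) : {poly F}) <= j.+1 - i)%N.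
  by apply: leq_trans (size_scale_leq _ _) _; rewrite size_polyXn subSn // (leq_trans le_ik (ltnW lt_kj)).
have lt_d : (size (d *: 'X^(j - i) : {poly F}) < size f)%N.
  by rewrite sf; apply: leq_ltn_trans sd _; rewrite ltn_subrL i_gt0.
have sg : size g = size f by rewrite size_polyDl.
have mg : g \is monic by rewrite monicE lead_coefDl.
split; first by rewrite mem_monics mg sg sf eqxx.
have gf : g - f = d *: 'X^(j - i) by rewrite /g addrC addKr.
have g0 : g`_0 = f`_0.
  by rewrite coefD coefZ coefXn ltn_eqF ?mulr0 ?addr0 // subn_gt0 (leq_ltn_trans le_ik).
rewrite /mixed_char g0 mulrA -psiD; congr (psi _ * _).
have lt_i1k : (i.-1 < k)%N by rewrite prednK.
rewrite (bigD1 (Ordinal lt_i1k)) //= [RHS](_ : _ = xi`_i.-1 * power_sum f i - d * c +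
    \sum_(l < k | l != Ordinal lt_i1k) xi`_l * power_sum f l.+1); last first.
  rewrite (bigD1 (Ordinal lt_i1k)) //= prednK // addrA; congr (_ + _).
  by rewrite /d divfK // opprK addrC.
have pert l : (l <= i)%N -> power_sum g l = power_sum f l - (l%:R * d) *+ (l == i).
  move=> le_li; rewrite (power_sum_perturb (i := i) mf mg sg) ?gf ?sf //.
    by rewrite coefZ coefXn eqxx mulr1.
  by rewrite ltnS (leq_trans le_ik (ltnW lt_kj)).
congr (_ + _).
  rewrite prednK // pert // eqxx mulr1n mulrBr; congr (_ - _).
  by rewrite /c /lead_coef; ring.
apply: eq_bigr => l ne; case: (ltnP l i) => [lt_li|le_il]; last first.
  by rewrite nth_default ?mul0r.
rewrite pert //; case: eqP => [E|_]; rewrite ?mulr0n ?subr0 //.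
by case/eqP: ne; apply: val_inj; rewrite /= -E.
Qed.

(** Multiply the constant term by u. *)
Lemma monic_sum_multiplicative j : xi = 0 -> (exists2 u, u != 0 & chi u != 1) ->
  (0 < j)%N -> monic_sum lam j = 0.
Proof.
move=> xi0 [u u0 chiu] j_gt0.
apply: (@monic_sum_shift _ (fun f => f + ((u - 1) * f`_0)%:P) (chi u)) => // [f g E|f].
  have E0 : f`_0 = g`_0.
    have := congr1 (fun h : {poly F} => h`_0) E; rewrite /= !coefD !coefC !eqxx.
    have e (x : F) : x + (u - 1) * x = u * x by ring.
    by rewrite !e => /(mulfI u0).
  by move: E; rewrite E0 => /addIr.
move=> fj; have /andP[mf /eqP sf] := etrans (esym (mem_monics j f)) fj.
have lt : (size ((u - 1) * f`_0)%:P < size f)%N.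
  by rewrite sf ltnS (leq_trans (size_polyC_leq1 _)).
split; first by rewrite mem_monics monicE lead_coefDl // size_polyDl // sf eqxx -monicE mf.
have lam0 g : lam g = chi g`_0.
  by rewrite /mixed_char big1 ?psi_0 ?mul1r // => i _; rewrite xi0 coef0 mul0r.
by rewrite !lam0 coefD coefC eqxx -chiM; congr chi; ring.
Qed.

(** Weil's bound.  In the even degrees the numbers z^2, for z in w, play the
part of the entries in [power_sums_growth]. *)
Lemma prime_power_sum_bound m : (xi != 0) \/ (exists2 u, u != 0 & chi u != 1) ->
  (0 < m)%N -> `|prime_power_sum lam m| <= k%:R * sqrtC q%:R ^+ m.
Proof.
move=> nontriv; case: m => // m _.
have logd m1 : m1.+1%:R * monic_sum lam m1.+1 =
    \sum_(i < m1.+1) prime_power_sum lam i.+1 * monic_sum lam (m1 - i)%N.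
  by apply: log_derivative => f g; apply: mixed_charM.
have q0 : 0 <= q%:R :> algC by rewrite ler0n.
have [xi0|xi0] := eqVneq xi 0.
  have nt : exists2 u, u != 0 & chi u != 1 by case: nontriv; rewrite ?xi0 ?eqxx.
  have [|w] := newton_inversion monic_sum_0 (k := 0) _ logd.
    by move=> j; apply: monic_sum_multiplicative.
  rewrite leqn0 size_eq0 => /eqP-> /(_ m)->.
  by rewrite big_nil oppr0 normr0 mulr_ge0 ?ler0n // exprn_ge0 // sqrtC_ge0.
have [w sw Sw] := newton_inversion monic_sum_0 (fun j => @monic_sum_additive j xi0) logd.
have w_le z : z \in w -> `|z| <= sqrtC q%:R.
  move=> zw; rewrite -(ler_pXn2r (ltn0Sn 1)) ?nnegrE ?sqrtC_ge0 //.
  rewrite sqrtCK -normrX.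
  (* The summand k covers the exponent 0. *)
pose b : algC := (curve_const xi + 1 + k)%:R.
  apply: (@power_sums_growth [seq z ^+ 2 | z <- w] b) => // [n|]; last exact: map_f.
  rewrite big_map -natrX -natrM.
  case: n => [|n].
    under eq_bigr => x _ do rewrite expr0.
    rewrite big_const_seq count_predT iter_addr_0 normr_nat ler_nat expn0 muln1.
    by rewrite (leq_trans sw) // leq_addl.
  under eq_bigr => x _ do rewrite -exprM mul2n doubleS.
  rewrite -normrN -Sw -doubleS.
  apply: le_trans (prime_power_sum_even_bound pF lt_kp psi_norm psi_sum chi0 chi_norm size_xi xi0 (ltn0Sn n)) _.
  rewrite ler_nat; move: (curve_const xi) => B.
  rewrite !mulnDl mul1n -[X in (X <= _)%N]addn1 -addnA leq_add2l (leq_trans _ (leq_addr _ _)) //.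
  by rewrite expn_gt0 (ltnW (finNzRing_gt1 F)).
rewrite Sw normrN; apply: le_trans (ler_norm_sum _ _ _) _.
apply: (@le_trans _ _ (\sum_(z <- w) sqrtC q%:R ^+ m.+1)).
  rewrite [leLHS]big_seq [leRHS]big_seq ler_sum // => z zw.
  by rewrite normrX lerXn2r ?nnegrE ?sqrtC_ge0 // w_le.
rewrite big_const_seq count_predT iter_addr_0 -[X in X <= _]mulr_natl ler_wpM2r ?ler_nat //.
by rewrite exprn_ge0 // sqrtC_ge0.
Qed.

End RiemannHypothesis.

(** * Existence of characters *)

Section Characters.

Variable F : finFieldType.
Local Notation q := #|F|.

Lemma irr_abelian_sum (gT : finGroupType) (G : {group gT}) (i : Iirr G) :
  i != 0 -> \sum_(x in G) 'chi_i x = 0.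
Proof.
move=> i0; have := cfdot_irr i 0; rewrite (negbTE i0) irr0 cfdotE => /eqP.
rewrite mulf_eq0 invr_eq0 pnatr_eq0 -[#|G| == _]negbK -lt0n cardG_gt0 /= => /eqP E.
rewrite -[RHS]E; apply: eq_bigr => x xG.
by rewrite cfun1E xG rmorph1 mulr1.
Qed.

(** Any nontrivial irreducible character of the additive group will do. *)
Lemma additive_character : exists psi : F -> algC,
  [/\ forall x y, psi (x + y) = psi x * psi y, forall x, `|psi x| = 1 &
      \sum_x psi x = 0].
Proof.
pose G := [set: F]%G.
have abG : abelian G by exact: FinRing.zmod_abelian.
have cN : Nirr G = q.
  by rewrite NirrE; move: abG; rewrite card_classes_abelian => /eqP->; rewrite cardsT.
have [i i0] : exists i : Iirr G, i != 0.
  have lt1 : (1 < Nirr G)%N by rewrite cN finNzRing_gt1.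
  by exists (Ordinal lt1); rewrite -val_eqE.
have lin : 'chi_i \is a linear_char by have /char_abelianP := abG.
exists 'chi_i; split.
- by move=> x y; rewrite -(lin_charM lin) ?inE.
- by move=> x; rewrite normC_lin_char ?inE.
- by rewrite -[RHS](irr_abelian_sum i0); apply: eq_bigl => x; rewrite inE.
Qed.

(** The characters of the units modulo G, extended by 0 to F, with the
orthogonality relation that detects the cosets of G. *)
Lemma coset_characters (G : {group {unit F}}) :
  exists (J : finType) (j0 : J) (chi : J -> F -> algC),
  [/\ (#|J| * #|G| = q.-1)%N,
      forall x, chi j0 x = (x != 0)%:R,
      forall j, [/\ forall x y, chi j (x * y) = chi j x * chi j y,
                    chi j 0 = 0, chi j 1 = 1, forall x, `|chi j x| <= 1 &
                    j != j0 -> exists2 u, u != 0 & chi j u != 1] &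
      forall u h : {unit F}, \sum_j chi j (FinRing.uval u) * (chi j (FinRing.uval h))^* =
                         #|J|%:R * (u \in (h *: G)%g)%:R].
Proof.
pose U := [set: {unit F}]%G.
have abU : abelian U by apply/cyclic_abelian/field_unit_group_cyclic.
have nGU : (G <| U)%g by rewrite -(sub_abelian_normal _ abU) ?subsetT.
pose Q := (U / G)%G.
have abQ : abelian Q by exact: quotient_abelian.
pose J := Iirr Q; pose e (u : {unit F}) := coset G u.
have eQ u : e u \in Q by apply: mem_quotient; rewrite inE.
have eM u v : e (u * v)%g = (e u * e v)%g.
  by rewrite /e morphM // (subsetP (normal_norm nGU)) ?inE.
pose chi (j : J) (x : F) : algC :=
  oapp (fun u : {unit F} => 'chi_j (e u)) 0 (insub x).
have chiu j (u : {unit F}) : chi j (FinRing.uval u) = 'chi_j (e u).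
  by rewrite /chi -[FinRing.uval u]/(val u) valK.
have chi0 j : chi j 0 = 0.
  by rewrite /chi insubN // unitr0.
have unitP (x : F) : x != 0 -> exists u : {unit F}, x = FinRing.uval u.
  rewrite -unitfE => ux; by exists (FinRing.unit F ux).
have lin (j : J) : 'chi_j \is a linear_char by have /char_abelianP := abQ.
have nG u : u \in 'N(G)%g by rewrite (subsetP (normal_norm nGU)) ?inE.
have chiM j x y : chi j (x * y) = chi j x * chi j y.
  have [->|/unitP[u ->]] := eqVneq x 0; first by rewrite mul0r !chi0 mul0r.
  have [->|/unitP[v ->]] := eqVneq y 0; first by rewrite mulr0 !chi0 mulr0.
  have -> : FinRing.uval u * FinRing.uval v = FinRing.uval (u * v)%g by [].
  by rewrite !chiu eM (lin_charM (lin j)) ?eQ.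
have cJ : #|J| = #|Q|.
  by rewrite card_ord NirrE; move: abQ; rewrite card_classes_abelian => /eqP.
exists J, 0, chi; split.
- rewrite cJ card_quotient ?normal_norm // mulnC Lagrange ?subsetT //.
  by rewrite -card_finField_unit.
- move=> x; have [->|/unitP[u Eu]] := eqVneq x 0; first by rewrite chi0.
  by rewrite Eu chiu irr0 cfun1E eQ.
- move=> j; split=> // [|x|j0].
  + by rewrite -[1]/(FinRing.uval (1%g : {unit F})) chiu /e morph1 lin_char1.
  + have [->|/unitP[u ->]] := eqVneq x 0; first by rewrite chi0 normr0 ler01.
    by rewrite chiu (normC_lin_char (lin j) (eQ u)) lexx.
  + have [/existsP[u /andP[uQ u1]]|/existsPn none] :=
        boolP [exists u : coset_of G, (u \in Q) && ('chi_j u != 1)].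
      have [w _ Ew] := cosetP u; exists (FinRing.uval w); last by rewrite chiu /e -Ew.
      by rewrite -unitfE; case: w {Ew}.
    have /eqP := irr_abelian_sum j0; rewrite (eq_bigr (fun=> 1)) => [|u uQ].
      by rewrite sumr_const pnatr_eq0 -[_ == _]negbK -lt0n cardG_gt0.
    by have := none u; rewrite uQ /= negbK => /eqP.
- move=> u h; under eq_bigr => j _ do rewrite !chiu.
  rewrite (second_orthogonality_relation _ (eQ h)).
  transitivity (#|Q|%:R * (u \in (h *: G)%g)%:R : algC); last first.
    by congr (_%:R * _); rewrite -cJ.
  rewrite (setIidPl _); last by rewrite sub_cent1; apply: (subsetP abQ); exact: eQ.
  rewrite mulr_natr; congr (_ *+ _).
  have -> : (e h ^: Q)%g = [set e h].
    by have /abelian_classP/(_ _ (eQ h)) := abQ.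
  rewrite inE; congr nat_of_bool; apply/eqP/idP => [/(rcoset_kercosetP (nG u) (nG h))|].
    by rewrite norm_rlcoset.
  by rewrite -norm_rlcoset // => uh; apply/(rcoset_kercosetP (nG u) (nG h)).

Qed.

End Characters.

(** * Additive Fourier analysis of power sums *)

Section PowerSumFourier.

Variables (F : finFieldType) (p n : nat).
Local Notation q := #|F|.
Hypothesis pF : p \in [pchar F].
Hypothesis lt_np : (n < p)%N.
Hypothesis n_gt0 : (0 < n)%N.
Let k := n.-1.
Implicit Types (f g : {poly F}).

(** The leading coefficient is left out as well: the relation is meant for
monic polynomials of degree n. *)
Definition same_middle f g := [forall i : 'I_n, (0 < i)%N ==> (f`_i == g`_i)].

(** Triangularity of Newton's identities: the first coefficient, from the top,
in which f and g differ would change the corresponding power sum by i times a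
nonzero element, and i is invertible because i < n < p. *)
Lemma power_sum_middle f g : f \in monics F n -> g \in monics F n ->
  [forall l : 'I_k, power_sum f l.+1 == power_sum g l.+1] = same_middle f g.
Proof.
rewrite !mem_monics => /andP[mf /eqP sf] /andP[mg /eqP sg].
have lc (h : {poly F}) : h \is monic -> size h = n.+1 -> h`_n = 1.
  by move=> mh sh; have := monicP mh; rewrite /lead_coef sh.
have sgf i : (i <= n)%N -> (forall j, (n - i < j < n)%N -> g`_j = f`_j) ->
    (size (g - f)%R <= n.+1 - i)%N.
  move=> le_in agree; apply/leq_sizeP => j le_j; rewrite coefB.
  case: (ltngtP j n) => [lt|gt|->]; last by rewrite !lc // subrr.
    rewrite agree ?subrr //; rewrite lt andbT; move: le_j le_in; clear; lia.
  by rewrite !nth_default ?subrr // ?sf ?sg.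
apply/forallP/forallP => /= H.
  have main i : (0 < i < n)%N -> g`_(n - i) = f`_(n - i).
    elim/ltn_ind: i => i IH /andP[i_gt0 lt_in].
    have szi : (size (g - f)%R <= size f - i)%N.
      rewrite sf; apply: sgf (ltnW lt_in) _ => j /andP[lt_j lt_jn].
      rewrite -(subKn (ltnW lt_jn)); apply: IH; first by move: lt_j lt_jn; clear; lia.
      by move: lt_j lt_jn; clear; lia.
    have lt_ik : (i.-1 < k)%N by rewrite /k; move: i_gt0 lt_in; clear; lia.
    have := power_sum_perturb mf mg (etrans sg (esym sf)) _ szi (leqnn i).
    rewrite sf ltnS (ltnW lt_in) => /(_ isT); rewrite eqxx mulr1n /=.
    have /eqP := H (Ordinal lt_ik); rewrite /= prednK // => -> /eqP.
    rewrite -subr_eq0 opprB addrC subrK mulf_eq0 -(dvdn_pcharf pF).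
    rewrite gtnNdvd ?(ltn_trans lt_in lt_np) //= coefB subr_eq0 => /eqP //.
  move=> i; apply/implyP => i_gt0; rewrite eq_sym; apply/eqP.
  rewrite -(subKn (ltnW (ltn_ord i))); apply: main.
  by have := ltn_ord i; move: i_gt0; clear; lia.
move=> l.
have szn : (size (g - f)%R <= size f - n)%N.
  rewrite sf; apply: sgf => // j; rewrite subnn => /andP[j0 jn].
  by have /implyP/(_ j0)/eqP := H (Ordinal jn).
have lt_ln : (l.+1 < n)%N by rewrite -[X in (_ < X)%N](prednK n_gt0) ltnS ltn_ord.
have := power_sum_perturb mf mg (etrans sg (esym sf)) _ szn (ltnW lt_ln).
by rewrite sf ltnSn (ltn_eqF lt_ln) mulr0n subr0 => ->.
Qed.

Lemma card_box (A : 'I_n -> {set F}) :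
  count (fun f => [forall i : 'I_n, f`_i \in A i]) (monics F n) = (\prod_i #|A i|)%N.
Proof.
have -> : (\prod_i #|A i|)%N = #|(family (fun i => mem (A i)))|.
  by rewrite card_family foldrE big_map big_enum.
pose phi (r : {poly_n F}) := [ffun i : 'I_n => (r : {poly F})`_i].
have phi_inj : injective phi.
  move=> r s E; apply/npolyP => i; have [lt_in|le] := ltnP i n.
    by have := congr1 (fun h : {ffun 'I_n -> F} => h (Ordinal lt_in)) E; rewrite !ffunE.
  by rewrite !big_coef_npoly.
have phi_bij : bijective phi.
  by apply: inj_card_bij; rewrite // card_ffun card_ord card_npoly.
rewrite -sum1_card (reindex phi) /=; last by apply: onW_bij.
rewrite count_map -size_filter -sum1_size big_filter big_enum_cond /=.
apply: eq_bigl => r; apply/forallP/familyP => /= H i; have := H i; rewrite ffunE.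
  by rewrite coefD coefXn ltn_eqF // add0r.
by rewrite coefD coefXn ltn_eqF // add0r.
Qed.

Variable psi : F -> algC.
Hypothesis psiD : forall x y, psi (x + y) = psi x * psi y.
Hypothesis psi_norm : forall x, `|psi x| = 1.
Hypothesis psi_sum : \sum_x psi x = 0.

Definition pairing (xi f : {poly F}) := \sum_(i < k) xi`_i * power_sum f i.+1.

Lemma sum_psi_linear (w : 'I_k -> F) :
  \sum_(xi : {poly_k F}) psi (\sum_(i < k) xi`_i * w i) =
  (q ^ k)%:R * [forall i, w i == 0]%:R.
Proof.
case: (boolP [forall i, w i == 0]) => [/forallP w0|].
  rewrite (eq_bigr (fun=> 1)) => [|xi _]; first by rewrite sumr_const card_npoly mulr1.
  rewrite big1 ?(psi_0 psiD psi_norm) // => i _.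
  by rewrite (eqP (w0 i)) mulr0.
rewrite negb_forall => /existsP[i wi0]; rewrite mulr0.
have [a a1] := psi_nontrivial psi_sum.
pose c : {poly_k F} := npolyp k ((a / w i) *: 'X^i).
set S := \sum_(xi : _) _.
have : S = psi a * S.
  rewrite {1}/S (reindex_inj (addrI c)) mulr_sumr; apply: eq_bigr => xi _.
  rewrite -psiD; congr psi.
  have -> : a = \sum_(j < k) (c : {poly F})`_j * w j.
    rewrite (bigD1 i) //= big1 ?addr0.
      by rewrite coef_npolyp ltn_ord coefZ coefXn eqxx mulr1 divfK.
    move=> j ne; rewrite coef_npolyp ltn_ord coefZ coefXn.
    by rewrite -[_ == _]/(j == i) (negbTE ne) mulr0 mul0r.
  by rewrite -big_split; apply: eq_bigr => j _ /=; rewrite -mulrDl -coefD.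
move/eqP; rewrite -subr_eq0 -{1}[S]mul1r -mulrBl mulf_eq0 subr_eq0 eq_sym (negbTE a1).
by move/eqP.
Qed.

(** Orthogonality of the additive characters, read through [power_sum_middle].
*)
Lemma middle_detect f g : f \in monics F n -> g \in monics F n ->
  \sum_(xi : {poly_k F}) psi (pairing xi f - pairing xi g) =
  (q ^ k)%:R * (same_middle f g)%:R.
Proof.
move=> fn gn; rewrite -power_sum_middle //.
rewrite (eq_bigr (fun xi : {poly_k F} => psi (\sum_(i < k) xi`_i * (power_sum f i.+1 - power_sum g i.+1)))).
  rewrite sum_psi_linear; congr (_ * _%:R).
  by congr nat_of_bool; apply: eq_forallb => i; rewrite subr_eq0.
move=> xi _; congr psi; rewrite /pairing -sumrB.
by apply: eq_bigr => i _; rewrite mulrBr.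
Qed.

End PowerSumFourier.

(** * From prime powers to irreducible polynomials *)

Section IrreducibleSums.

Variable F : finFieldType.
Local Notation q := #|F|.

Lemma prime_power_sum_one m : (0 < m)%N -> prime_power_sum (fun _ : {poly F} => 1 : algC) m = (q ^ m)%:R.
Proof.
move=> m_gt0; have [L [iota card_L]] := finField_extension F m_gt0.
have := sum_conj m_gt0 card_L (iota := iota) (lam := fun=> 1 : algC) (g := fun=> 1) (fun _ _ _ => erefl).
by rewrite sumr_const card_L.
Qed.

(** Each element of the field with q^m elements has one minimal polynomial. *)
Lemma sum_card_irreds m : (0 < m)%N ->
  (\sum_(d <- divisors m) d * size (irreds F d) = q ^ m)%N.
Proof.
move=> m_gt0; apply/eqP; rewrite -(eqr_nat algC).
rewrite -prime_power_sum_one // natr_sum; apply/eqP; apply: eq_bigr => d _.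
by rewrite -mulr_sumr big_const_seq count_predT iter_addr_0 natrM.
Qed.

Lemma card_irreds_le d : (0 < d)%N -> (d * size (irreds F d) <= q ^ d)%N.
Proof.
move=> d_gt0; rewrite -sum_card_irreds // (bigD1_seq d) ?divisors_uniq ?leq_addr //.
exact: divisors_id.
Qed.

(** The term d = n of the divisor sum is the sum over irreducible polynomials;
the others have d <= n/2 and contribute at most q^d each. *)
Lemma prime_power_sum_irreds (lam : {poly F} -> algC) n : (0 < n)%N ->
  (forall f, `|lam f| <= 1) ->
  `|prime_power_sum lam n - n%:R * \sum_(f <- irreds F n) lam f| <= n%:R * sqrtC q%:R ^+ n.
Proof.
move=> n_gt0 lam1; set s := sqrtC _.
have s_ge1 : 1 <= s by rewrite -sqrtC1 ler_sqrtC ?nnegrE ?ler01 ?ler0n // ler1n ltnW ?finNzRing_gt1.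
have s_ge0 : 0 <= s by apply: le_trans ler01 s_ge1.
rewrite /prime_power_sum (bigD1_seq n) ?divisors_uniq ?divisors_id //= divnn n_gt0.
under eq_bigr => P _ do rewrite expr1.
rewrite -mulr_sumr addrAC subrr add0r.
apply: le_trans (ler_norm_sum _ _ _) _.
apply: (@le_trans _ _ (\sum_(d <- divisors n | d != n) s ^+ n)).
  rewrite [leLHS]big_seq_cond [leRHS]big_seq_cond ler_sum // => d /andP[].
  rewrite -dvdn_divisors // => dn ne.
  have d_gt0 : (0 < d)%N by apply: dvdn_gt0 dn.
  apply: le_trans (ler_norm_sum _ _ _) _.
  apply: (@le_trans _ _ (q ^ d)%:R).
    apply: (@le_trans _ _ (\sum_(P <- irreds F d) d%:R)).
      by apply: ler_sum => P _; rewrite normrM normr_nat ler_piMr ?ler0n.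
    rewrite big_const_seq count_predT iter_addr_0 -mulrnA ler_nat.
    exact: card_irreds_le.
  rewrite natrX -[q%:R]sqrtCK -/s -exprM ler_weXn2l //.
  case/dvdnP: dn ne n_gt0 => [[|[|e]]] ->; first by rewrite mul0n.
    by rewrite mul1n eqxx.
  by move=> _ _; rewrite leq_mul2r orbT.
rewrite big_const_seq iter_addr_0 -[leLHS]mulr_natl ler_wpM2r ?exprn_ge0 // ler_nat.
apply: leq_trans (count_size _ _) _.
rewrite -[leqRHS](size_iota 1); apply: uniq_leq_size; rewrite ?divisors_uniq //.
move=> d; rewrite -dvdn_divisors // => dn; rewrite mem_iota (dvdn_gt0 n_gt0 dn) add1n ltnS.
exact: dvdn_leq.
Qed.

End IrreducibleSums.

(** * Fourier expansion of the count *)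

Section CosetCount.

Variables (F : finFieldType) (p n : nat).
Local Notation q := #|F|.
Hypothesis pF : p \in [pchar F].
Hypothesis lt_np : (n < p)%N.
Hypothesis n_ge2 : (1 < n)%N.
Variables (h : 'I_n -> {unit F}) (G : 'I_n -> {group {unit F}}).

Let k := n.-1.
Let n_gt0 : (0 < n)%N := ltnW n_ge2.
Let o0 : 'I_n := Ordinal n_gt0.
Implicit Types (f g : {poly F}).

Definition coset_set (i : 'I_n) : {set F} := FinRing.uval @: (h i *: G i)%g.

Lemma card_coset_set i : #|coset_set i| = #|G i|.
Proof. by rewrite card_imset ?card_lcoset //; exact: val_inj. Qed.

Definition in_box f := [forall i : 'I_n, f`_i \in coset_set i].

Lemma card_irred_cosets : #|irred_cosets h G| = count in_box (irreds F n).
Proof.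
rewrite cardE -(size_map (fun f : {poly_n.+1 F} => (f : {poly F}))) -size_filter.
apply/perm_size/uniq_perm.
- by rewrite map_inj_uniq ?enum_uniq //; exact: val_inj.
- by rewrite filter_uniq ?irreds_uniq.
move=> f; rewrite mem_filter mem_irreds; apply/mapP/idP => [[g]|].
  rewrite mem_enum inE => /and4P[mg sg ig bg] ->.
  by rewrite ig mg sg /in_box bg.
move=> /and4P[bf irf mf /eqP sf].
have sf' : (size f <= n.+1)%N by rewrite sf.
exists (npolyp n.+1 f); last by rewrite npolypK.
by rewrite mem_enum inE npolypK // mf sf eqxx irf.
Qed.

(** Representatives of the classes of [same_middle] that meet the box are
normalized to have constant coefficient 0. *)
Definition middle_box (i : 'I_n) := if i == o0 then [set 0] else coset_set i.
Definition box_reps := [seq g : {poly F} <- monics F n | [forall i : 'I_n, g`_i \in middle_box i]].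

Lemma box_reps_uniq : uniq box_reps.
Proof. by rewrite filter_uniq ?monics_uniq. Qed.

Lemma size_box_reps : (#|G o0| * size box_reps = \prod_i #|G i|)%N.
Proof.
rewrite size_filter card_box (bigD1 o0) // [RHS](bigD1 o0) //=.
rewrite {1}/middle_box eqxx cards1 mul1n; congr (_ * _)%N.
by apply: eq_bigr => i ne; rewrite /middle_box (negbTE ne) card_coset_set.
Qed.

Lemma size_box_reps_le : (size box_reps <= q ^ k)%N.
Proof.
rewrite size_filter card_box (bigD1 o0) //= {1}/middle_box eqxx cards1 mul1n.
apply: (@leq_trans (\prod_(i < n | i != o0) q)).
  by apply: leq_prod => i _; exact: max_card.
by rewrite prod_nat_const cardC1 card_ord.
Qed.

Lemma mem_box_reps g : g \in box_reps -> [/\ g \in monics F n, g`_0 = 0 &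
  forall i : 'I_n, i != o0 -> g`_i \in coset_set i].
Proof.
rewrite mem_filter => /andP[/forallP bg gn]; split=> //.
  by have := bg o0; rewrite /middle_box eqxx inE => /eqP.
by move=> i ne; have := bg i; rewrite /middle_box (negbTE ne).
Qed.

Definition middle_in_box f :=
  [forall i : 'I_n, (i != o0) ==> (f`_i \in coset_set i)].

Lemma sum_same_middle f : f \in monics F n ->
  (\sum_(g <- box_reps) same_middle n f g = middle_in_box f)%N.
Proof.
move=> fn; case: (boolP (middle_in_box f)) => [/forallP bf|].
  pose g0 := f - (f`_0)%:P.
  have g0i i : g0`_i = if i == 0%N then 0 else f`_i.
    by rewrite coefB coefC; case: eqP => [->|_]; rewrite ?subrr ?subr0.
  have g0n : g0 \in monics F n.
    move: fn; rewrite !mem_monics => /andP[mf /eqP sf].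
    have lt : (size (- (f`_0)%:P) < size f)%N.
      by rewrite size_polyN sf ltnS (leq_trans (size_polyC_leq1 _)).
    by rewrite monicE lead_coefDl // size_polyDl // sf eqxx -monicE mf.
  have g0E : g0 \in box_reps.
    rewrite mem_filter g0n andbT; apply/forallP => i; rewrite g0i /middle_box.
    rewrite -[i == o0]/((i : nat) == 0%N); case: eqP => [_|/eqP ne]; first by rewrite inE.
    by have /implyP := bf i; apply.
  rewrite (bigD1_seq g0) ?box_reps_uniq //= big1_seq ?addn0.
    have -> // : same_middle n f g0.
    by apply/forallP => i; apply/implyP => i_gt0; rewrite g0i (gtn_eqF i_gt0).
  move=> g /andP[ne /mem_box_reps[gn g_0 _]]; apply/eqP; rewrite eqb0.
  apply: contra ne => /forallP H; apply/eqP/polyP => i; rewrite g0i.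
  case: eqP => [->|/eqP i0]; first by rewrite g_0.
  have [lt|] := ltnP i n.
    by have /implyP := H (Ordinal lt); rewrite lt0n => /(_ i0)/eqP.
  move: fn gn; rewrite !mem_monics => /andP[mf /eqP sf] /andP[mg /eqP sg].
  rewrite leq_eqVlt => /orP[/eqP <-|lt]; last by rewrite !nth_default ?sf ?sg.
  by have := monicP mf; have := monicP mg; rewrite /lead_coef sf sg /= => -> ->.
rewrite /middle_in_box negb_forall => /existsP[i]; rewrite negb_imply => /andP[ne fi].
rewrite big1_seq // => g /andP[_ /mem_box_reps[_ _ bg]].
apply/eqP; rewrite eqb0; apply: contra fi => /forallP/(_ i)/implyP H.
rewrite (eqP (H _)); first exact: bg.
by rewrite lt0n.
Qed.

Lemma sum_box_reps_pairs (g : {poly F}) : g \in box_reps ->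
  (\sum_(g' <- box_reps) same_middle n g g' = 1)%N.
Proof.
move=> /mem_box_reps[gn _ bg]; rewrite sum_same_middle //.
by have -> // : middle_in_box g; apply/forallP => i; apply/implyP/bg.
Qed.

Lemma irreds_coef0 f : f \in irreds F n -> exists u : {unit F}, f`_0 = FinRing.uval u.
Proof.
move=> fi; have [irr mf sf _] := irredsP fi.
have f0 : f`_0 != 0.
  apply/negP => f0; have X : 'X %| f by rewrite -['X]subr0 dvdp_XsubCl /root horner_coef0.
  have := irr.2 _ _ X; rewrite size_polyX => /(_ isT)/eqp_size.
  by rewrite size_polyX sf => -[E]; move: n_ge2; rewrite -E.
by rewrite -unitfE in f0; exists (FinRing.unit F f0).
Qed.

Lemma mem_coset_set i (u : {unit F}) : (FinRing.uval u \in coset_set i) = (u \in (h i *: G i)%g).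
Proof. by rewrite mem_imset //; exact: val_inj. Qed.

Lemma in_boxE f (u : {unit F}) : f`_0 = FinRing.uval u -> in_box f =
  middle_in_box f && (u \in (h o0 *: G o0)%g).
Proof.
move=> Eu; apply/forallP/andP => [H|[/forallP H uh] i].
  split; first by apply/forallP => i; apply/implyP.
  by have := H o0; rewrite Eu mem_coset_set.
have [->|ne] := eqVneq i o0; first by rewrite Eu mem_coset_set.
by have /implyP := H i; apply.
Qed.

Section Fourier.

Variable psi : F -> algC.
Hypothesis psiD : forall x y, psi (x + y) = psi x * psi y.
Hypothesis psi_norm : forall x, `|psi x| = 1.
Hypothesis psi_sum : \sum_x psi x = 0.

Let s : algC := sqrtC q%:R.
Let E_hat (xi : {poly F}) : algC := \sum_(g <- box_reps) psi (- pairing n xi g).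

Let s_ge1 : 1 <= s.
Proof. by rewrite -sqrtC1 ler_sqrtC ?nnegrE ?ler01 ?ler0n // ler1n ltnW ?finNzRing_gt1. Qed.

Let qE j : (q ^ j)%:R = s ^+ (2 * j) :> algC.
Proof. by rewrite natrX exprM sqrtCK. Qed.

Lemma psiN x : psi (- x) = (psi x)^*.
Proof.
have px0 : psi x != 0 by rewrite -normr_gt0 psi_norm ltr01.
apply: (mulfI px0); rewrite -psiD subrr (psi_0 psiD psi_norm) -normCK psi_norm.
by rewrite expr1n.
Qed.

(** Parseval, for the indicator function of the set of power sum vectors of
[box_reps]. *)
Lemma sum_E_hat_sq : \sum_(xi : {poly_k F}) `|E_hat xi| ^+ 2 = (q ^ k * size box_reps)%:R.
Proof.
transitivity (\sum_(g <- box_reps) \sum_(g' <- box_reps)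
   \sum_(xi : {poly_k F}) psi (pairing n xi g - pairing n xi g')).
  under [RHS]eq_bigr => g _ do rewrite exchange_big.
  rewrite [RHS]exchange_big; apply: eq_bigr => xi _ /=.
  rewrite normCK mulrC {1}/E_hat rmorph_sum mulr_suml; apply: eq_bigr => g _.
  rewrite mulr_sumr; apply: eq_bigr => g' _.
  by rewrite /= -psiN opprK -psiD.
transitivity (\sum_(g <- box_reps) (q ^ k)%:R : algC).
  apply: eq_big_seq => g gE; have [gn _ _] := mem_box_reps gE.
  transitivity ((q ^ k)%:R * (\sum_(g' <- box_reps) same_middle n g g')%:R : algC); last first.
    by rewrite sum_box_reps_pairs // mulr1.
  rewrite natr_sum mulr_sumr.
  apply: eq_big_seq => g' /mem_box_reps[g'n _ _].
  by rewrite (middle_detect pF lt_np n_gt0 psiD psi_norm psi_sum).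
by rewrite big_const_seq count_predT iter_addr_0 -mulrnA.
Qed.

(** Cauchy-Schwarz over the q^k frequencies, in the form |x| <= (|x|^2 / t +
t) / 2 with t = q^(k/2).  Before normalization by q^(-k) the bound q^(k/2)
reads q^(3k/2) = s^(3k). *)
Lemma sum_E_hat : \sum_(xi : {poly_k F}) `|E_hat xi| <= s ^+ (3 * k).
Proof.
have s_gt0 : 0 < s by apply: lt_le_trans ltr01 s_ge1.
have t_gt0 : 0 < s ^+ k by rewrite exprn_gt0.
have amgm (x : algC) : 0 <= x -> x <= (x ^+ 2 / s ^+ k + s ^+ k) / 2%:R.
  move=> x0; rewrite ler_pdivlMr ?ltr0n // -(ler_pM2r t_gt0) mulrDl divfK ?gt_eqF //.
  rewrite -subr_ge0 (_ : _ - _ = (x - s ^+ k) ^+ 2); last by ring.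
  by rewrite real_exprn_even_ge0 // realB ?ger0_real // ltW.
apply: (@le_trans _ _ (\sum_(xi : {poly_k F}) (`|E_hat xi| ^+ 2 / s ^+ k + s ^+ k) / 2%:R)).
  by apply: ler_sum => xi _; apply: amgm.
rewrite -mulr_suml big_split /= -mulr_suml sum_E_hat_sq sumr_const card_npoly.
rewrite ler_pdivrMr ?ltr0n // mulr_natr mulr2n lerD //.
  rewrite ler_pdivrMr // -exprD natrM.
  apply: (@le_trans _ _ ((q ^ k)%:R * (q ^ k)%:R)).
    by rewrite ler_wpM2l ?ler0n // ler_nat size_box_reps_le.
  by rewrite qE -exprD (_ : (2 * k + 2 * k = 3 * k + k)%N) //; clear; lia.
by rewrite -[X in X <= _]mulr_natl qE -exprD -mulSnr.
Qed.

(** Combine the Fourier expansion with the bounds for the character sums.  The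
main term is q/(q-1) times the product of the orders, because the constant
coefficient of an irreducible polynomial ranges over F^* only; the difference
is at most q^k. *)
Lemma coset_count_algC :
  `|(n * count in_box (irreds F n))%:R - (\prod_i #|G i|)%:R| <= (3 * n)%:R * s ^+ (n + k).
Proof.
have s_ge0 : 0 <= s by apply: le_trans ler01 s_ge1.
have [J [j0 [chi [cJ chij0 chiP orth]]]] := coset_characters (G o0).
pose T xi j := n%:R * \sum_(f <- irreds F n) mixed_char k psi (chi j) xi f.
(* T' is T without its main term, which is present for the trivial character only. *)
pose dlt (xi : {poly_k F}) j : algC := ((xi == 0) && (j == j0))%:R.
pose T' (xi : {poly_k F}) j := T xi j - dlt xi j * (q ^ n)%:R.
have lam_le1 xi j f : `|mixed_char k psi (chi j) xi f| <= 1.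
  by rewrite /mixed_char normrM psi_norm mul1r; have [_ _ _ ->] := chiP j.
have T'le (xi : {poly_k F}) j : `|T' xi j| <= (2 * n)%:R * s ^+ n.
  have low := prime_power_sum_irreds n_gt0 (lam_le1 xi j).
  rewrite /T' /dlt; case: (boolP (_ && _)) => [/andP[/eqP xi0 /eqP jj0]|nt].
    have one_le (f : {poly F}) : `|1 : algC| <= 1 by rewrite normr1.
    have := @prime_power_sum_irreds F (fun=> 1) n n_gt0 one_le.
    rewrite prime_power_sum_one // mul1r distrC -/s => le.
    have -> : T xi j = n%:R * \sum_(f <- irreds F n) 1.
      congr (_ * _); apply: eq_big_seq => f fi.
      have [u Eu] := irreds_coef0 fi.
      have u0 : FinRing.uval u != 0 by rewrite -unitfE; case: (u).
      rewrite /mixed_char big1 ?(psi_0 psiD psi_norm) => [|i _]; last by rewrite xi0 coef0 mul0r.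
      by rewrite jj0 chij0 Eu u0 mulr1.
    apply: le_trans le _; rewrite ler_wpM2r ?exprn_ge0 // ler_nat.
    by rewrite leq_pmull.
  have [chiM chi0 chi1 chi_le1 chi_nt] := chiP j.
  rewrite mul0r subr0 -[T xi j](subrK (prime_power_sum (mixed_char k psi (chi j) xi) n)).
  rewrite mul2n -addnn natrD mulrDl; apply: le_trans (ler_normD _ _) _; apply: lerD.
    by rewrite distrC; exact: low.
  have lt_kp : (k < p)%N by apply: leq_ltn_trans lt_np; exact: leq_pred.
  apply: le_trans (_ : k%:R * s ^+ n <= _); last first.
    by rewrite ler_wpM2r ?exprn_ge0 // ler_nat leq_pred.
  apply: (prime_power_sum_bound pF lt_kp psiD psi_norm psi_sum chiM chi0 chi1 chi_le1 (size_npoly xi)) => //.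
  have [xi0|xi0] := eqVneq xi 0; last by left.
  by right; apply: chi_nt; apply: contra nt => ->; rewrite xi0 eqxx.
have key : (n * count in_box (irreds F n))%:R * ((q ^ k)%:R * #|J|%:R) =
    \sum_(xi : {poly_k F}) \sum_j E_hat xi * (chi j (FinRing.uval (h o0)))^* * T xi j.
  transitivity (n%:R * \sum_(f <- irreds F n) (\sum_(xi : {poly_k F}) E_hat xi * psi (pairing n xi f)) *
      (\sum_j chi j f`_0 * (chi j (FinRing.uval (h o0)))^*)); last first.
    rewrite mulr_sumr.
    under eq_bigr => f _ do rewrite mulr_suml mulr_sumr.
    rewrite exchange_big; apply: eq_bigr => xi _ /=.
    under eq_bigr => f _ do rewrite 2!mulr_sumr.
    rewrite exchange_big; apply: eq_bigr => j _ /=.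
    rewrite /T 2!mulr_sumr; apply: eq_bigr => f _.
    by rewrite /mixed_char -/(pairing n xi f); ring.
  rewrite natrM -mulrA; congr (_ * _).
  rewrite -sum1_count natr_sum mulr_suml big_mkcond; apply: eq_big_seq => f fi /=.
  have fn : f \in monics F n by move: fi; rewrite mem_filter => /andP[].
  have [u Eu] := irreds_coef0 fi.
  have -> : \sum_(xi : {poly_k F}) E_hat xi * psi (pairing n xi f) = (q ^ k)%:R * (middle_in_box f)%:R.
    under eq_bigr => xi _ do rewrite mulr_suml.
    rewrite exchange_big -(sum_same_middle fn) natr_sum mulr_sumr.
    apply: eq_big_seq => g /mem_box_reps[gn _ _] /=.
    rewrite -(middle_detect pF lt_np n_gt0 psiD psi_norm psi_sum fn gn).
    by apply: eq_bigr => xi _; rewrite -psiD addrC.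
  rewrite Eu orth (in_boxE Eu).
  by case: (middle_in_box f); case: (u \in _); rewrite /= ?mulr0 ?mulr1 ?mul0r ?mul1r.
pose Err := \sum_(xi : {poly_k F}) \sum_j E_hat xi * (chi j (FinRing.uval (h o0)))^* * T' xi j.
have Err_le : `|Err| <= s ^+ (3 * k) * #|J|%:R * ((2 * n)%:R * s ^+ n).
  apply: le_trans (ler_norm_sum _ _ _) _.
  apply: (@le_trans _ _ (\sum_(xi : {poly_k F}) `|E_hat xi| * (#|J|%:R * ((2 * n)%:R * s ^+ n)))).
    apply: ler_sum => xi _; apply: le_trans (ler_norm_sum _ _ _) _.
    apply: (@le_trans _ _ (\sum_(j : J) `|E_hat xi| * ((2 * n)%:R * s ^+ n))); last first.
      by rewrite sumr_const -[X in X <= _]mulr_natl mulrCA.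
    apply: ler_sum => j _.
    rewrite !normrM norm_conjC -mulrA ler_wpM2l //.
    apply: le_trans (T'le xi j); rewrite ler_piMl //.
    by have [_ _ _ ->] := chiP j.
  by rewrite -mulr_suml -[leRHS]mulrA ler_wpM2r ?mulr_ge0 ?exprn_ge0 ?ler0n // sum_E_hat.
have main : \sum_(xi : {poly_k F}) \sum_j E_hat xi * (chi j (FinRing.uval (h o0)))^* * T xi j =
     (size box_reps * q ^ n)%:R + Err.
  apply/eqP; rewrite -subr_eq -sumrB; apply/eqP.
  rewrite (bigD1 0) //= [X in _ + X]big1 ?addr0 => [|xi ne].
    rewrite -sumrB (bigD1 j0) //= [X in _ + X]big1 ?addr0 => [|j ne].
      rewrite -mulrBr /T' opprB addrC subrK /dlt !eqxx mul1r chij0 natrM; congr (_ * _).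
      have u0 : FinRing.uval (h o0) != 0 by rewrite -unitfE; case: (h o0).
      rewrite u0 conjC1 mulr1 /E_hat (eq_bigr (fun=> 1)) => [|g _].
        by rewrite big_const_seq count_predT iter_addr_0.
      by rewrite /pairing big1 ?oppr0 ?(psi_0 psiD psi_norm) // => i _; rewrite coef0 mul0r.
    by rewrite -mulrBr /T' /dlt (negbTE ne) andbF mul0r subr0 subrr mulr0.
  rewrite -sumrB big1 // => j _.
  by rewrite -mulrBr /T' /dlt (negbTE ne) mul0r subr0 subrr mulr0.
have J_gt0 : (0 < #|J|)%N by rewrite (cardD1 j0) inE.
have c_gt0 : 0 < (q ^ k)%:R * #|J|%:R :> algC.
  by rewrite -natrM ltr0n muln_gt0 J_gt0 expn_gt0 (ltnW (finNzRing_gt1 F)).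
rewrite -(ler_pM2r c_gt0) -{1}(gtr0_norm c_gt0) -normrM mulrBl key main -size_box_reps.
set e := size box_reps.
have -> : (e * q ^ n)%:R + Err - (#|G o0| * e)%:R * ((q ^ k)%:R * #|J|%:R) =
    (e * q ^ k)%:R + Err.
  rewrite addrAC; congr (_ + _); apply/eqP; rewrite subr_eq -!natrM -natrD eqr_nat.
  have -> : (#|G o0| * e * (q ^ k * #|J|) = q.-1 * (e * q ^ k))%N.
    by rewrite -cJ; ring.
  by rewrite -mulSn prednK ?(ltnW (finNzRing_gt1 F)) // -(prednK n_gt0) expnS mulnCA.
apply: le_trans (ler_normD _ _) _; rewrite normr_nat.
apply: le_trans (lerD (lexx _) Err_le) _.
have -> : s ^+ (3 * k) * #|J|%:R * ((2 * n)%:R * s ^+ n) =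
    (2 * n)%:R * s ^+ (n + k) * ((q ^ k)%:R * #|J|%:R).
  by rewrite qE (_ : (3 * k = k + 2 * k)%N) ?mulSn // !exprD; ring.
have -> : (3 * n)%:R = n%:R + (2 * n)%:R :> algC by rewrite -natrD -mulSn.
rewrite 2!mulrDl lerD2r natrM mulrC mulrCA ler_wpM2l ?ler0n //.
apply: (@le_trans _ _ (s ^+ (n + k))).
  apply: (@le_trans _ _ (q ^ k)%:R); first by rewrite ler_nat size_box_reps_le.
  by rewrite qE ler_weXn2l // mul2n -addnn leq_add2r leq_pred.
rewrite -[X in X <= _]mul1r mulrAC ler_wpM2r ?exprn_ge0 //.
by rewrite -natrM ler1n muln_gt0 n_gt0.
Qed.

End Fourier.
End CosetCount.

(** * The theorem *)

Lemma normr_nat_sub (R : numDomainType) (a b : nat) :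
  `|a%:R - b%:R| = ((a - b) + (b - a))%N%:R :> R.
Proof.
wlog le_ab : a b / (a <= b)%N.
  by move=> H; case/orP: (leq_total a b) => [/H //|/H]; rewrite distrC addnC.
rewrite distrC (eqP le_ab) add0n natrB // ger0_norm // subr_ge0 ler_nat //.
Qed.

(** An inequality between natural numbers, so that it can be carried from the
algebraic numbers to any real field. *)
Lemma coset_count_nat (F : finFieldType) (p n : nat) :
    p \in [pchar F] -> (n < p)%N -> (1 < n)%N ->
  forall (h : 'I_n -> {unit F}) (G : 'I_n -> {group {unit F}}) (a b : nat),
  a = (n * #|irred_cosets h G|)%N -> b = (\prod_i #|G i|)%N ->
  (((a - b) + (b - a)) ^ 2 <= (3 * n) ^ 2 * #|F| ^ (n + n.-1))%N.
Proof.
move=> pF lt_np n_ge2 h G a b Ea Eb; have [psi [psiD psi_norm psi_sum]] := additive_character F.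
have := coset_count_algC pF lt_np n_ge2 h G psiD psi_norm psi_sum.
rewrite -card_irred_cosets -Ea -Eb normr_nat_sub => le.
rewrite -(ler_nat algC) natrX.
apply: le_trans (lerXn2r 2 _ _ le) _; rewrite ?nnegrE ?ler0n ?mulr_ge0 ?exprn_ge0 ?sqrtC_ge0 ?ler0n //.
by rewrite exprMn -exprM [((n + n.-1) * 2)%N]mulnC exprM sqrtCK -!natrX -natrM lexx.
Qed.

Theorem corollary1p2 (R : realType) :
  exists C : R, 0 < C /\
    forall (F : finFieldType) (p n : nat),
      p \in [pchar F] -> (n < p)%N -> (2 <= n)%N ->
      forall (h : 'I_n -> {unit F}) (G : 'I_n -> {group {unit F}}),
        let q : R := #|F|%:R in
        `| #|irred_cosets h G|%:R
           - n%:R^-1 * \prod_(j < n) #|G j|%:R |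
        <= C * (n%:R ^+ 2 * q `^ (n%:R - 2^-1)
                + n%:R ^+ 5 * q ^+ n.-1).
Proof.
exists 3%:R; split=> // F p n pF lt_np n_ge2 h G; cbv zeta; set q : R := #|F|%:R.
have := coset_count_nat pF lt_np n_ge2 (erefl (n * #|irred_cosets h G|)%N) (erefl (\prod_i #|G i|)%N).
set a := (n * _)%N; set b := (\prod_i _)%N; set D := (_ + _)%N => le.
have n0 : 0 < n%:R :> R by rewrite ltr0n ltnW.
have q0 : 0 <= q by rewrite ler0n.
have -> : #|irred_cosets h G|%:R - n%:R^-1 * \prod_(j < n) #|G j|%:R =
    n%:R^-1 * (a%:R - b%:R) :> R.
  by rewrite mulrBr /a natrM mulKf ?gt_eqF // /b natr_prod.
rewrite normrM normr_nat_sub -/D normfV normr_nat.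
set t := q `^ _; have t0 : 0 <= t by exact: powR_ge0.
have Et : t ^+ 2 = q ^+ (n + n.-1).
  rewrite -powR_mulrn // -powRrM -[RHS]powR_mulrn //; congr (_ `^ _).
  have -> : n%:R = n.-1%:R + 1 :> R by rewrite natr1 prednK // ltnW.
  rewrite mulrBl mulVf ?pnatr_eq0 // natrD.
  have -> : n%:R = n.-1%:R + 1 :> R by rewrite natr1 prednK // ltnW.
  by ring.
have leD : D%:R <= (3 * n)%:R * t.
  rewrite -(ler_pXn2r (ltn0Sn 1)) ?nnegrE ?mulr_ge0 ?ler0n //.
  by rewrite exprMn Et -!natrX -natrM ler_nat.
apply: (@le_trans _ _ (3%:R * t)).
  by rewrite ler_pdivrMl // (le_trans leD) // natrM -mulrA mulrCA.
rewrite ler_pM2l ?ltr0n // -[X in X <= _]addr0 lerD //.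
  by rewrite ler_peMl // exprn_ege1 // ler1n ltnW.
by rewrite mulr_ge0 // exprn_ge0 // ltW.
Qed.
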